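(* Let $(R,H)$ be a commutative Hopf algebroid that is flat over its base ring $R$. Let $A$ be an Azumaya $H$-comodule $R$-algebra such that $A\otimes_RA\,|\,A$ simultaneously in the category of $H$-comodules and of $A$-bimodules (that is, as $A$-bimodules in the category of $H$-comodules). Assume that $R[1]$ is a generator in the category $\mathsf{Comod}_H$ of right $H$-comodules. Then there is an isomorphism of groups $$\mathrm{Inv}^H_R(A)\cong\mathrm{Aut}^H_{R\text{-alg}}(A).$$
   Context: $(R,H)$ has source and target maps $s,t:R\to H$, counit $\varepsilon$, comultiplication $\Delta:H\to H\otimes_RH$ and antipode; flat means $H$ is a flat $R$-module. A right $H$-comodule is an $R$-module $M$ with a counital coassociative coaction $\varrho_M:M\to M\otimes_RH$ (tensor product formed using $s$ on $H$; $\varrho_M$ is $R$-linear for the $R$-action on $M\otimes_R H$ induced by $t$). $\mathsf{Comod}_H$ is a symmetric monoidal Grothendieck category under $\otimes_R$ with the flip, with unit object $R[1]$, i.e. $R$ with coaction $t:R\to H\cong R\otimes_RH$. An $H$-comodule $R$-algebra is a monoid $A$ in $\mathsf{Comod}_H$. It is Azumaya if, with $A^e=A\otimes_RA^o$ ($A^o$ the opposite monoid), the functor $A\otimes_R-:\mathsf{Comod}_H\to{}_{A^e}(\mathsf{Comod}_H)$ into the category of left $A^e$-modules ($=A$-bimodules) in $\mathsf{Comod}_H$ is an equivalence and the multiplication $A\otimes_RA\to A$ splits as a morphism of $A$-bimodules in $\mathsf{Comod}_H$. $M|N$, for $A$-bimodules $M,N$ in $\mathsf{Comod}_H$, means there are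 $k\ge1$ and morphisms $f_i:M\to N$, $g_i:N\to M$ ($1\le i\le k$) that are both $H$-colinear and $A$-bilinear with $\sum_i g_i\circ f_i=\mathrm{Id}_M$; $A\otimes_RA$ is an $A$-bimodule via its outer sides. $\mathrm{Aut}^H_{R\text{-alg}}(A)$ is the group of $H$-colinear $R$-algebra automorphisms of $A$. $\mathrm{Inv}_R^H(A)$ is the set of $H$-subcomodules (subobjects in $\mathsf{Comod}_H$) $i_X:X\hookrightarrow A$ for which there exist an $H$-subcomodule $i_Y:Y\hookrightarrow A$ and isomorphisms of $H$-comodules $m_X:X\otimes_RY\to R[1]$, $m_Y:Y\otimes_RX\to R[1]$ such that, with $m,u$ the multiplication and unit of $A$, $u\circ m_X=m\circ(i_X\otimes_Ri_Y)$ and $u\circ m_Y=m\circ(i_Y\otimes_Ri_X)$; it is a group under $X\cdot X'=(X\otimes_RX',\,m\circ(i_X\otimes_Ri_{X'}))$ with neutral element $(R[1],u)$. *)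

(* Defs.v *)
From HB Require Import structures.
From mathcomp Require Import all_boot generic_quotient all_algebra.
From mathcomp Require Import boolp.

Set Implicit Arguments.
Unset Strict Implicit.
Unset Printing Implicit Defensive.

Import GRing.Theory.
Local Open Scope ring_scope.

Reserved Notation "x \ox y" (at level 40, left associativity).

(* The tensor product M \ox_R N of modules over a commutative ring: formal
   sums of pairs, that is lists, modulo the least additive congruence making
   (m, n) |-> [:: (m, n)] biadditive and R-balanced. *)
Section TensorProduct.
Variables (R : comPzRingType) (M N : lmodType R).

Inductive tens_eq : seq (M * N) -> seq (M * N) -> Prop :=
| tens_refl x : tens_eq x x
| tens_sym x y : tens_eq x y -> tens_eq y x
| tens_trans y x z : tens_eq x y -> tens_eq y z -> tens_eq x z
| tens_cat x x' y y' :
    tens_eq x x' -> tens_eq y y' -> tens_eq (x ++ y) (x' ++ y')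
| tens_catC x y : tens_eq (x ++ y) (y ++ x)
| tens_zerol n : tens_eq [:: (0, n)] [::]
| tens_addl m m' n : tens_eq [:: (m + m', n)] [:: (m, n); (m', n)]
| tens_addr m n n' : tens_eq [:: (m, n + n')] [:: (m, n); (m, n')]
| tens_bal a m n : tens_eq [:: (a *: m, n)] [:: (m, a *: n)].

Definition tens_rel : rel (seq (M * N)) := fun x y => `[< tens_eq x y >].

Lemma tens_rel_refl : reflexive tens_rel.
Proof. by move=> x; apply/asboolP; apply: tens_refl. Qed.
Lemma tens_rel_sym : symmetric tens_rel.
Proof. by move=> x y; apply/asboolP/asboolP; apply: tens_sym. Qed.
Lemma tens_rel_trans : transitive tens_rel.
Proof.
by move=> y x z /asboolP xy /asboolP yz; apply/asboolP; apply: tens_trans xy yz.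
Qed.

Canonical tens_equiv_rel :=
  EquivRel tens_rel tens_rel_refl tens_rel_sym tens_rel_trans.

Definition tens : Type := {eq_quot tens_equiv_rel}%qT.
HB.instance Definition _ := Choice.on tens.
HB.instance Definition _ := Quotient.on tens.
HB.instance Definition _ := EqQuotient.on tens.

Definition tens_class (x : seq (M * N)) : tens := (\pi_tens x)%qT.

Definition tpure (m : M) (n : N) : tens := tens_class [:: (m, n)].

Lemma tens_classP x y : tens_eq x y <-> tens_class x = tens_class y.
Proof.
split=> [xy|]; first by apply/eqP; rewrite piE; apply/asboolP.
by move/eqP; rewrite /tens_class piE => /asboolP.
Qed.

Lemma tens_classK (z : tens) : tens_class (repr z) = z.
Proof. exact: reprK. Qed.

Lemma tens_repr x : tens_eq (repr (tens_class x)) x.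
Proof. by apply/tens_classP; rewrite tens_classK. Qed.

Definition tens_add (x y : tens) := tens_class (repr x ++ repr y).
Definition tens_opp (x : tens) := tens_class [seq (- p.1, p.2) | p <- repr x].
Definition tens_scale (a : R) (x : tens) :=
  tens_class [seq (a *: p.1, p.2) | p <- repr x].

Lemma tens_addE x y : tens_add (tens_class x) (tens_class y) = tens_class (x ++ y).
Proof. by apply/tens_classP; apply: tens_cat; apply: tens_repr. Qed.

Lemma tens_map_eq (f : M -> M) (x y : seq (M * N)) :
    f 0 = 0 -> {morph f : u v / u + v} -> (forall a, {morph f : u / a *: u}) ->
  tens_eq x y ->
  tens_eq [seq (f p.1, p.2) | p <- x] [seq (f p.1, p.2) | p <- y].
Proof.
move=> f0 fD fZ; elim=> {x y}.
- by move=> x; apply: tens_refl.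
- by move=> x y _; apply: tens_sym.
- by move=> y x z _ ? _; apply: tens_trans.
- by move=> x x' y y' _ ? _ ?; rewrite !map_cat; apply: tens_cat.
- by move=> x y; rewrite !map_cat; apply: tens_catC.
- by move=> n /=; rewrite f0; apply: tens_zerol.
- by move=> m m' n /=; rewrite fD; apply: tens_addl.
- by move=> m n n' /=; apply: tens_addr.
- by move=> a m n /=; rewrite fZ; apply: tens_bal.
Qed.

Lemma tens_oppE x :
  tens_opp (tens_class x) = tens_class [seq (- p.1, p.2) | p <- x].
Proof.
apply/tens_classP; apply: (tens_map_eq (f := -%R)) (tens_repr x) => //.
- by rewrite oppr0.
- by move=> u v; rewrite opprD.
- by move=> a u; rewrite scalerN.
Qed.

Lemma tens_scaleE a x :
  tens_scale a (tens_class x) = tens_class [seq (a *: p.1, p.2) | p <- x].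
Proof.
apply/tens_classP; apply: (tens_map_eq (f := *:%R a)) (tens_repr x) => //.
- by rewrite scaler0.
- by move=> u v; rewrite scalerDr.
- by move=> b u; rewrite !scalerA mulrC.
Qed.

Lemma tens_addA : associative tens_add.
Proof.
move=> x y z; rewrite -(tens_classK x) -(tens_classK y) -(tens_classK z).
by rewrite !tens_addE catA.
Qed.

Lemma tens_addC : commutative tens_add.
Proof.
move=> x y; rewrite -(tens_classK x) -(tens_classK y) !tens_addE.
by apply/tens_classP; apply: tens_catC.
Qed.

Lemma tens_add0 : left_id (tens_class [::]) tens_add.
Proof. by move=> x; rewrite -(tens_classK x) tens_addE. Qed.

Lemma tens_addN : left_inverse (tens_class [::]) tens_opp tens_add.
Proof.
move=> x; rewrite -(tens_classK x) tens_oppE tens_addE; apply/tens_classP.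
elim: (repr x) => [|[m n] s IHs] /=; first exact: tens_refl.
set s' := map _ s in IHs *.
apply: tens_trans ((s' ++ s) ++ [:: (- m, n); (m, n)]) _ _ _ _; last first.
  rewrite -[[::]]/([::] ++ [::]); apply: tens_cat IHs _.
  apply: tens_trans (tens_sym (tens_addl _ _ _)) _.
  by rewrite addNr; apply: tens_zerol.
apply/tens_classP; rewrite -cat1s -[in s' ++ _]cat1s.
rewrite -[[:: (- m, n); _]]/([:: (- m, n)] ++ [:: (m, n)]) -!tens_addE.
set a := tens_class [:: (- m, n)]; set b := tens_class [:: (m, n)].
rewrite tens_addA (tens_addC a) -!tens_addA; congr tens_add.
by rewrite tens_addA tens_addC.
Qed.

HB.instance Definition _ :=
  GRing.isZmodule.Build tens tens_addA tens_addC tens_add0 tens_addN.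

Lemma tens_class_cat x y : tens_class (x ++ y) = tens_class x + tens_class y.
Proof. by rewrite -tens_addE. Qed.

Lemma tens_scaleA a b v : tens_scale a (tens_scale b v) = tens_scale (a * b) v.
Proof.
rewrite -(tens_classK v) !tens_scaleE -map_comp; congr tens_class.
by apply: eq_map => p /=; rewrite scalerA.
Qed.

Lemma tens_scale1 : left_id 1 tens_scale.
Proof.
move=> v; rewrite -(tens_classK v) !tens_scaleE; congr tens_class.
by rewrite -[RHS]map_id; apply: eq_map => -[m n] /=; rewrite scale1r.
Qed.

Lemma tens_scaleDr : right_distributive tens_scale +%R.
Proof.
move=> a x y; rewrite -(tens_classK x) -(tens_classK y) -tens_class_cat.
by rewrite !tens_scaleE map_cat tens_class_cat.
Qed.

Lemma tens_scaleDl v : {morph tens_scale^~ v : a b / a + b}.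
Proof.
move=> a b; rewrite -(tens_classK v) /= !tens_scaleE.
elim: (repr v) => [|[m n] s IHs] /=; first by rewrite addr0.
have consE p (x : seq (M * N)) : tens_class (p :: x) = tens_class [:: p] + tens_class x.
  by rewrite -tens_class_cat.
rewrite consE IHs [X in _ = X + _]consE [X in _ = _ + X]consE addrACA.
congr (_ + _).
rewrite -tens_class_cat; apply/tens_classP; rewrite scalerDl.
exact: tens_addl.
Qed.

HB.instance Definition _ :=
  GRing.Zmodule_isLmodule.Build R tens
    tens_scaleA tens_scale1 tens_scaleDr tens_scaleDl.

Local Notation "m \ox n" := (tpure m n).

Lemma tpureDl m m' n : (m + m') \ox n = m \ox n + m' \ox n.
Proof. by rewrite -tens_class_cat; apply/tens_classP; apply: tens_addl. Qed.
Lemma tpureDr m n n' : m \ox (n + n') = m \ox n + m \ox n'.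
Proof. by rewrite -tens_class_cat; apply/tens_classP; apply: tens_addr. Qed.
Lemma tpureZl a m n : (a *: m) \ox n = a *: (m \ox n).
Proof. by rewrite -[RHS]/(tens_scale a _) tens_scaleE. Qed.
Lemma tpureZr a m n : m \ox (a *: n) = a *: (m \ox n).
Proof.
by rewrite -tpureZl; apply/tens_classP; apply: tens_sym; apply: tens_bal.
Qed.
Lemma tpure0l n : 0 \ox n = 0.
Proof. by apply/tens_classP; apply: tens_zerol. Qed.

Lemma tens_ind (P : tens -> Prop) :
    (forall m n, P (m \ox n)) -> (forall x y, P x -> P y -> P (x + y)) ->
  forall x, P x.
Proof.
move=> Pp PD x; rewrite -(tens_classK x); elim: (repr x) => [|[m n] s IHs].
  by rewrite -[tens_class [::]]/(0 : tens) -(tpure0l 0); apply: Pp.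
by rewrite -cat1s tens_class_cat; apply: PD IHs; apply: Pp.
Qed.

Section Lift.
Variable P : zmodType.

Record balanced (b : M -> N -> P) : Prop := Balanced {
  balDl : forall m m' n, b (m + m') n = b m n + b m' n;
  balDr : forall m n n', b m (n + n') = b m n + b m n';
  balZ : forall a m n, b (a *: m) n = b m (a *: n) }.

(* The additive map M \ox N -> P induced by a balanced map b; junk when b is
   not balanced. *)
Definition tlift (b : M -> N -> P) (x : tens) : P :=
  \sum_(p <- repr x) b p.1 p.2.

Variable b : M -> N -> P.
Hypothesis bP : balanced b.

Lemma tlift_eq x y : tens_eq x y ->
  \sum_(p <- x) b p.1 p.2 = \sum_(p <- y) b p.1 p.2.
Proof.
elim=> {x y} //.
- by move=> y x z _ -> _ ->.
- by move=> x x' y y' _ IHx _ IHy; rewrite !big_cat /= IHx IHy.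
- by move=> x y; rewrite !big_cat /= addrC.
- move=> n; rewrite big_nil big_seq1 /=; apply: (addrI (b 0 n)).
  by rewrite -(balDl bP) !addr0.
- by move=> m m' n; rewrite !big_cons !big_nil /= !addr0 (balDl bP).
- by move=> m n n'; rewrite !big_cons !big_nil /= !addr0 (balDr bP).
- by move=> a m n; rewrite !big_seq1 /= (balZ bP).
Qed.

Lemma tlift_class x : tlift b (tens_class x) = \sum_(p <- x) b p.1 p.2.
Proof. exact: tlift_eq (tens_repr x). Qed.

Lemma tliftE m n : tlift b (m \ox n) = b m n.
Proof. by rewrite tlift_class big_seq1. Qed.

Lemma tliftD : {morph tlift b : x y / x + y}.
Proof.
move=> x y; rewrite -(tens_classK x) -(tens_classK y) -tens_class_cat.
by rewrite !tlift_class big_cat.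
Qed.

End Lift.

Lemma tliftZ (P : lmodType R) (b : M -> N -> P) : balanced b ->
    (forall a m n, b (a *: m) n = a *: b m n) ->
  forall a x, tlift b (a *: x) = a *: tlift b x.
Proof.
move=> bP bZ a; apply: tens_ind => [m n|x y IHx IHy].
  by rewrite -tpureZl !tliftE.
by rewrite scalerDr !tliftD // IHx IHy scalerDr.
Qed.

End TensorProduct.

Notation "m \ox n" := (tpure m n) : ring_scope.

Section TensorMaps.
Variable R : comPzRingType.

Record bilin (M M' P : lmodType R) (b : M -> M' -> P) : Prop := Bilin {
  bilDl : forall m m' n, b (m + m') n = b m n + b m' n;
  bilDr : forall m n n', b m (n + n') = b m n + b m n';
  bilZl : forall a m n, b (a *: m) n = a *: b m n;
  bilZr : forall a m n, b m (a *: n) = a *: b m n }.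

Lemma bilin_balanced (M M' P : lmodType R) (b : M -> M' -> P) :
  bilin b -> balanced b.
Proof. by case=> Dl Dr Zl Zr; split=> // a m n; rewrite Zl Zr. Qed.

Lemma bilin_tpure (M N : lmodType R) : bilin (@tpure R M N).
Proof.
by split=> *; rewrite ?tpureDl ?tpureDr ?tpureZl ?tpureZr.
Qed.

Definition tmap (M M' N N' : lmodType R) (f : M -> M') (g : N -> N') :
  tens M N -> tens M' N' := tlift (fun m n => f m \ox g n).

Section TmapTheory.
Variables (M M' N N' : lmodType R).
Variables (f : {linear M -> M'}) (g : {linear N -> N'}).

Lemma tmap_balanced : balanced (fun m n => f m \ox g n).
Proof.
by split=> *; rewrite ?linearD ?linearZ ?tpureDl ?tpureDr ?tpureZl ?tpureZr.
Qed.

Lemma tmapE m n : tmap f g (m \ox n) = f m \ox g n.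
Proof. exact: (tliftE tmap_balanced). Qed.

Lemma tmap_linear : linear (tmap f g).
Proof.
move=> a x y; rewrite /tmap tliftD ?tliftZ //; try exact: tmap_balanced.
by move=> b m n; rewrite linearZ tpureZl.
Qed.

HB.instance Definition _ :=
  GRing.isLinear.Build R _ _ _ (tmap f g) tmap_linear.
End TmapTheory.

(* (x \ox y) (x' \ox y') |-> b x x' \ox c y y'. *)
Definition tens2 (M M' P N N' Q : lmodType R)
    (b : M -> M' -> P) (c : N -> N' -> Q) (x : tens M N) (y : tens M' N') :
  tens P Q := tlift (fun m n => tlift (fun m' n' => b m m' \ox c n n') y) x.

Section Tens2Theory.
Variables (M M' P N N' Q : lmodType R).
Variables (b : M -> M' -> P) (c : N -> N' -> Q).
Hypotheses (bP : bilin b) (cP : bilin c).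

Lemma tens2_bal1 m n : balanced (fun m' n' => b m m' \ox c n n').
Proof.
case: bP cP => ? bDr ? bZr [? cDr ? cZr].
by split=> *; rewrite ?bDr ?cDr ?bZr ?cZr ?tpureDl ?tpureDr ?tpureZl ?tpureZr.
Qed.

Lemma tens2_bal2 y :
  balanced (fun m n => tlift (fun m' n' => b m m' \ox c n n') y).
Proof.
case: bP cP => bDl ? bZl ? [cDl ? cZl ?].
split=> [m m' n|m n n'|a m n]; elim/tens_ind: y => [u v|x y IHx IHy].
- by rewrite !tliftE ?bDl ?tpureDl //; apply: tens2_bal1.
- by rewrite !tliftD ?IHx ?IHy 1?addrACA //; apply: tens2_bal1.
- by rewrite !tliftE ?cDl ?tpureDr //; apply: tens2_bal1.
- by rewrite !tliftD ?IHx ?IHy 1?addrACA //; apply: tens2_bal1.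
- by rewrite !tliftE ?bZl ?cZl ?tpureZl ?tpureZr //; apply: tens2_bal1.
- by rewrite !tliftD ?IHx ?IHy //; apply: tens2_bal1.
Qed.

Lemma tens2E m n m' n' : tens2 b c (m \ox n) (m' \ox n') = b m m' \ox c n n'.
Proof.
by rewrite /tens2 !tliftE //; [apply: tens2_bal1 | apply: tens2_bal2].
Qed.

Lemma tens2Dl x x' y : tens2 b c (x + x') y = tens2 b c x y + tens2 b c x' y.
Proof. by rewrite /tens2 tliftD //; apply: tens2_bal2. Qed.

Lemma tens2Dr x y y' : tens2 b c x (y + y') = tens2 b c x y + tens2 b c x y'.
Proof.
elim/tens_ind: x => [m n|x x' IHx IHx']; last first.
  by rewrite !tens2Dl IHx IHx' addrACA.
by rewrite /tens2 !tliftE ?tliftD //; try exact: tens2_bal2; apply: tens2_bal1.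
Qed.

Lemma tens2_bilin : bilin (tens2 b c).
Proof.
split; [exact: tens2Dl|exact: tens2Dr| |] => a x y.
  elim/tens_ind: x => [m n|x x' IHx IHx']; last first.
    by rewrite scalerDr !tens2Dl IHx IHx' scalerDr.
  elim/tens_ind: y => [m' n'|y y' IHy IHy']; last first.
    by rewrite !tens2Dr IHy IHy' scalerDr.
  by rewrite -tpureZl !tens2E (bilZl bP) tpureZl.
elim/tens_ind: x => [m n|x x' IHx IHx']; last first.
  by rewrite !tens2Dl IHx IHx' scalerDr.
elim/tens_ind: y => [m' n'|y y' IHy IHy']; last first.
  by rewrite scalerDr !tens2Dr IHy IHy' scalerDr.
by rewrite -tpureZl !tens2E (bilZr bP) tpureZl.
Qed.
End Tens2Theory.

End TensorMaps.

(* H as an R-module through a ring morphism f : R -> H. *)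
Section RestrictScalars.
Variables (R H : comPzRingType) (f : {rmorphism R -> H}).

Definition resc of {rmorphism R -> H} : Type := H.
HB.instance Definition _ := GRing.ComPzRing.copy (resc f) H.

Definition resc_scale (a : R) (h : resc f) : resc f := (f a : resc f) * h.
Lemma resc_scaleA a b h : resc_scale a (resc_scale b h) = resc_scale (a * b) h.
Proof. by rewrite /resc_scale rmorphM mulrA. Qed.
Lemma resc_scale1 : left_id 1 resc_scale.
Proof. by move=> h; rewrite /resc_scale rmorph1 mul1r. Qed.
Lemma resc_scaleDr : right_distributive resc_scale +%R.
Proof. by move=> a x y; rewrite /resc_scale mulrDr. Qed.
Lemma resc_scaleDl h : {morph resc_scale^~ h : a b / a + b}.
Proof. by move=> a b; rewrite /resc_scale rmorphD mulrDl. Qed.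
HB.instance Definition _ := GRing.Zmodule_isLmodule.Build R (resc f)
  resc_scaleA resc_scale1 resc_scaleDr resc_scaleDl.

Lemma rescZE a (h : resc f) : a *: h = (f a : resc f) * h. Proof. by []. Qed.

Lemma resc_mul_bilin : bilin (fun x y : resc f => x * y).
Proof.
split=> *; rewrite ?rescZE ?mulrDl ?mulrDr ?mulrA //.
by congr (_ * _); rewrite mulrC.
Qed.
End RestrictScalars.

(* The module M \ox_R H, formed with s, with R acting through t. *)
Definition ext (R H : comPzRingType) (s t : {rmorphism R -> H})
  (M : lmodType R) : Type := tens M (resc s).

Section Extension.
Variables (R H : comPzRingType) (s t : {rmorphism R -> H}) (M : lmodType R).
Local Notation ext := (ext s t M).

HB.instance Definition _ := GRing.Zmodule.copy ext (tens M (resc s)).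

Definition ext_scale (a : R) (x : ext) : ext :=
  tmap (fun m : M => m) (fun h : resc s => (t a : resc s) * h) x.

Lemma ext_bal a :
  balanced (fun (m : M) (h : resc s) => m \ox ((t a : resc s) * h) : ext).
Proof.
split=> *; rewrite ?mulrDr ?tpureDl ?tpureDr // tpureZl -tpureZr.
by rewrite !rescZE mulrCA.
Qed.

Lemma ext_scaleE a (m : M) (h : resc s) :
  ext_scale a (m \ox h) = m \ox ((t a : resc s) * h).
Proof. exact: (tliftE (ext_bal a)). Qed.

Lemma ext_scaleDr : right_distributive ext_scale +%R.
Proof. by move=> a x y; exact: (tliftD (ext_bal a)). Qed.

Lemma ext_scaleA a b x : ext_scale a (ext_scale b x) = ext_scale (a * b) x.
Proof.
elim/tens_ind: x => [m h|x y IHx IHy]; last by rewrite !ext_scaleDr IHx IHy.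
by rewrite !ext_scaleE mulrA rmorphM.
Qed.

Lemma ext_scale1 : left_id 1 ext_scale.
Proof.
elim/tens_ind => [m h|x y IHx IHy]; last by rewrite ext_scaleDr IHx IHy.
by rewrite ext_scaleE rmorph1 mul1r.
Qed.

Lemma ext_scaleDl x : {morph ext_scale^~ x : a b / a + b}.
Proof.
move=> a b /=; elim/tens_ind: x => [m h|x y IHx IHy].
  by rewrite !ext_scaleE rmorphD mulrDl tpureDr.
by rewrite !ext_scaleDr IHx IHy addrACA.
Qed.

HB.instance Definition _ := GRing.Zmodule_isLmodule.Build R ext
  ext_scaleA ext_scale1 ext_scaleDr ext_scaleDl.

Definition epure (m : M) (h : H) : ext := m \ox (h : resc s).

Lemma epureDl m m' h : epure (m + m') h = epure m h + epure m' h.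
Proof. exact: tpureDl. Qed.
Lemma epureDr m h h' : epure m (h + h') = epure m h + epure m h'.
Proof. exact: (tpureDr m (h : resc s)). Qed.
Lemma epureZ a m h : epure (a *: m) h = epure m (s a * h).
Proof. by rewrite /epure tpureZl -tpureZr. Qed.
Lemma epure_scale a m h : a *: epure m h = epure m (t a * h).
Proof. exact: ext_scaleE. Qed.

Lemma ext_ind (P : ext -> Prop) :
    (forall m h, P (epure m h)) -> (forall x y, P x -> P y -> P (x + y)) ->
  forall x, P x.
Proof. exact: (@tens_ind R M (resc s) P). Qed.
End Extension.

Section ExtensionMap.
Variables (R H : comPzRingType) (s t : {rmorphism R -> H}).

Definition emap (M N : lmodType R) (f : M -> N) : ext s t M -> ext s t N :=
  tlift (fun m (h : resc s) => epure s t (f m) h).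

Lemma emap_balanced (M N : lmodType R) (f : {linear M -> N}) :
  balanced (fun m (h : resc s) => epure s t (f m) h).
Proof.
split=> *; rewrite ?linearD ?linearZ ?epureDl //; first exact: epureDr.
exact: epureZ.
Qed.

Lemma emapE (M N : lmodType R) (f : {linear M -> N}) m h :
  emap f (epure s t m h) = epure s t (f m) h.
Proof. exact: (tliftE (emap_balanced f)). Qed.

Lemma emap_linear (M N : lmodType R) (f : {linear M -> N}) : linear (emap f).
Proof.
have emapD : {morph emap f : x y / x + y} by exact: (tliftD (emap_balanced f)).
move=> a x y; rewrite emapD; congr (_ + _).
elim/ext_ind: x => [m h|x x' IHx IHx']; last first.
  by rewrite scalerDr !emapD IHx IHx' scalerDr.
by rewrite epure_scale !emapE epure_scale.
Qed.

HB.instance Definition _ (M N : lmodType R) (f : {linear M -> N}) :=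
  GRing.isLinear.Build R _ _ _ (emap f) (emap_linear f).
End ExtensionMap.

(* m \ox h |-> \sum (m \ox h_1) \ox h_2, where com h = \sum h_1 \ox h_2. *)
Definition ext_com (R H : comPzRingType) (s t : {rmorphism R -> H})
    (com : resc t -> ext s t (resc t)) (M : lmodType R) :
    ext s t M -> ext s t (ext s t M) :=
  tlift (fun (m : M) (h : resc s) =>
    tlift (fun (k : resc t) (l : resc s) => epure s t (epure s t m k) l)
      (com h)).

(* The tensor product H \ox_R H on which com takes its values is formed with t
   on the left factor and s on the right factor. *)
Record hopf_algebroid (R : comPzRingType) := HopfAlgebroid {
  hcar :> comPzRingType;
  src : {rmorphism R -> hcar};
  tgt : {rmorphism R -> hcar};
  cou : {rmorphism hcar -> R};
  com : {linear resc tgt -> ext src tgt (resc tgt)};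
  anti : {rmorphism hcar -> hcar};
  cou_src : forall r, cou (src r) = r;
  cou_tgt : forall r, cou (tgt r) = r;
  com_src : forall r, com (src r) = epure src tgt (src r : resc tgt) 1;
  com1 : com 1 = epure src tgt (1 : resc tgt) 1;
  comM : forall x y, com (x * y) =
    tens2 (fun h h' : resc tgt => h * h') (fun k k' : resc src => k * k')
      (com x) (com y);
  comA : forall x,
    emap com (com x) = ext_com com (com x);
  com_coul : forall x,
    tlift (fun (h : resc tgt) (k : resc src) => src (cou h) * k : hcar) (com x)
      = x;
  com_cour : forall x,
    tlift (fun (h : resc tgt) (k : resc src) => h * tgt (cou k) : hcar) (com x)
      = x;
  anti_src : forall r, anti (src r) = tgt r;
  anti_tgt : forall r, anti (tgt r) = src r;
  antil : forall x,
    tlift (fun (h : resc tgt) (k : resc src) => anti h * k : hcar) (com x)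
      = tgt (cou x);
  antir : forall x,
    tlift (fun (h : resc tgt) (k : resc src) => h * anti k : hcar) (com x)
      = src (cou x) }.

(* The four functions lifted in the axioms of hopf_algebroid are balanced. *)
Section HopfBalanced.
Variables (R : comPzRingType) (H : hopf_algebroid R).
Local Notation Ht := (resc (tgt H)).
Local Notation Hs := (resc (src H)).

Lemma com_coul_balanced :
  balanced (fun (h : Ht) (k : Hs) => src H (cou H h) * k : H).
Proof.
split=> [h h' k|h k k'|a h k]; first by rewrite !rmorphD mulrDl.
  by rewrite mulrDr.
rewrite -[a *: h]/(tgt H a * (h : H)) -[a *: k]/(src H a * (k : H)).
by rewrite !rmorphM cou_tgt mulrA [X in X * _]mulrC.
Qed.

Lemma com_cour_balanced :
  balanced (fun (h : Ht) (k : Hs) => h * tgt H (cou H k) : H).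
Proof.
split=> [h h' k|h k k'|a h k]; first by rewrite mulrDl.
  by rewrite !rmorphD mulrDr.
rewrite -[a *: h]/(tgt H a * (h : H)) -[a *: k]/(src H a * (k : H)).
by rewrite !rmorphM cou_src mulrA [X in X * _]mulrC.
Qed.

Lemma antil_balanced :
  balanced (fun (h : Ht) (k : Hs) => anti H h * k : H).
Proof.
split=> [h h' k|h k k'|a h k]; first by rewrite rmorphD mulrDl.
  by rewrite mulrDr.
rewrite -[a *: h]/(tgt H a * (h : H)) -[a *: k]/(src H a * (k : H)).
by rewrite !rmorphM anti_tgt mulrA [X in X * _]mulrC.
Qed.

Lemma antir_balanced :
  balanced (fun (h : Ht) (k : Hs) => h * anti H k : H).
Proof.
split=> [h h' k|h k k'|a h k]; first by rewrite mulrDl.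
  by rewrite rmorphD mulrDr.
rewrite -[a *: h]/(tgt H a * (h : H)) -[a *: k]/(src H a * (k : H)).
by rewrite !rmorphM anti_src mulrA [X in X * _]mulrC.
Qed.
End HopfBalanced.

(* H is flat as an R-module through s; by the antipode this is equivalent to
   flatness through t. *)
Definition flat (R : comPzRingType) (H : hopf_algebroid R) : Prop :=
  forall (M N : lmodType R) (f : {linear M -> N}), injective f ->
    injective (tmap f idfun : tens M (resc (src H)) -> tens N (resc (src H))).

Section Comodules.
Variables (R : comPzRingType) (H : hopf_algebroid R).
Local Notation s := (src H).
Local Notation t := (tgt H).
Local Notation "M ':oxH'" := (ext s t M) (at level 2, format "M ':oxH'").
Local Notation "m \oxh h" := (epure s t m h) (at level 40).

Definition ext_cou (M : lmodType R) : M:oxH -> M :=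
  tlift (fun (m : M) (h : resc s) => cou H h *: m).

Record comodule := Comodule {
  comod_mod :> lmodType R;
  coact : {linear comod_mod -> comod_mod:oxH};
  coact_cou : forall m, ext_cou (coact m) = m;
  coactA : forall m, emap coact (coact m) = ext_com (com H) (coact m) }.

Lemma ext_com_bal1 (M : lmodType R) (m : M) :
  balanced (fun (k : resc t) (l : resc s) => (m \oxh k) \oxh l).
Proof.
split=> [k k' l|k l l'|a k l]; rewrite ?epureDr ?epureDl //.
by rewrite -[a *: k]/(t a * (k : H)) -epure_scale epureZ.
Qed.

Lemma ext_com_bal2 (M : lmodType R) :
  balanced (fun (m : M) (h : resc s) =>
    tlift (fun (k : resc t) (l : resc s) => (m \oxh k) \oxh l) (com H h)).
Proof.
have b1 := @ext_com_bal1 M.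
split=> [m m' h|m h h'|a m h].
- elim/ext_ind: (com H h) => [k l|x y IHx IHy].
    by rewrite !tliftE // !epureDl.
  by rewrite !tliftD // IHx IHy addrACA.
- by rewrite (linearD (com H) (h : resc t)) tliftD.
rewrite -[a *: h]/(s a * (h : H)) comM com_src.
elim/ext_ind: (com H h) => [k l|x y IHx IHy]; last first.
  by rewrite tens2Dr ?tliftD ?IHx ?IHy //; apply: resc_mul_bilin.
rewrite tens2E ?tliftE //; try exact: resc_mul_bilin.
by rewrite epureZ mul1r.
Qed.

Lemma ext_comE (M : lmodType R) (m : M) (h : H) :
  ext_com (com H) (m \oxh h) =
    tlift (fun (k : resc t) (l : resc s) => (m \oxh k) \oxh l) (com H h).
Proof. exact: (tliftE (@ext_com_bal2 M)). Qed.

Lemma ext_comD (M : lmodType R) :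
  {morph @ext_com _ _ _ _ (com H) M : x y / x + y}.
Proof. exact: (tliftD (@ext_com_bal2 M)). Qed.

Lemma ext_cou_bal (M : lmodType R) :
  balanced (fun (m : M) (h : resc s) => cou H h *: m).
Proof.
split=> [m m' h|m h h'|a m h]; first by rewrite scalerDr.
  by rewrite rmorphD scalerDl.
by rewrite -[a *: h]/(s a * (h : H)) rmorphM cou_src scalerA mulrC.
Qed.

Lemma ext_couE (M : lmodType R) (m : M) (h : H) :
  ext_cou (m \oxh h) = cou H h *: m.
Proof. exact: (tliftE (@ext_cou_bal M)). Qed.

Lemma ext_couD (M : lmodType R) : {morph @ext_cou M : x y / x + y}.
Proof. exact: (tliftD (@ext_cou_bal M)). Qed.

Lemma ext_cou_linear (M : lmodType R) : linear (@ext_cou M).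
Proof.
move=> a x y; rewrite ext_couD; congr (_ + _).
elim/ext_ind: x => [m h|x x' IHx IHx']; last first.
  by rewrite scalerDr !ext_couD IHx IHx' scalerDr.
by rewrite epure_scale !ext_couE rmorphM cou_tgt scalerA.
Qed.
HB.instance Definition _ (M : lmodType R) :=
  GRing.isLinear.Build R _ _ _ (@ext_cou M) (@ext_cou_linear M).

Record colinear (M N : comodule) := Colinear {
  colin_fun :> M -> N;
  colin_linear : linear colin_fun;
  colin_coact : forall m, coact N (colin_fun m) = emap colin_fun (coact M m) }.

HB.instance Definition _ (M N : comodule) (f : colinear M N) :=
  GRing.isLinear.Build R M N _ (colin_fun f) (colin_linear f).

Lemma colinD (M N : comodule) (f : colinear M N) : {morph f : x y / x + y}.
Proof. exact: linearD. Qed.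
Lemma colinZ (M N : comodule) (f : colinear M N) a : {morph f : x / a *: x}.
Proof. by move=> x; rewrite linearZ. Qed.

Lemma colinearP (M N : comodule) (f g : colinear M N) : f =1 g -> f = g.
Proof.
case: f g => [f fl fc] [g gl gc] /= /funext fg; subst g.
by congr Colinear; apply: Prop_irrelevance.
Qed.

Lemma emap_id (M : lmodType R) : emap (fun m : M => m) =1 (id : M:oxH -> M:oxH).
Proof.
elim/ext_ind => [m h|x y IHx IHy]; first exact: (emapE _ _ idfun).
by rewrite (linearD (emap idfun)); congr (_ + _).
Qed.

Lemma emap_comp (M N P : lmodType R) (g : {linear N -> P}) (f : {linear M -> N})
  (x : M:oxH) : emap (fun m => g (f m)) x = emap g (emap f x) :> P:oxH.
Proof.
elim/ext_ind: x => [m h|x y IHx IHy].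
  by rewrite !emapE; exact: (emapE _ _ (g \o f)).
by rewrite !linearD (linearD (emap (g \o f))); congr (_ + _).
Qed.

Lemma colin_id_subproof (M : comodule) (m : M) :
  coact M m = emap (fun x => x) (coact M m).
Proof. by rewrite emap_id. Qed.

Lemma linear_id (M : comodule) : linear (fun m : M => m). Proof. by []. Qed.

Definition colin_id (M : comodule) : colinear M M :=
  Colinear (@linear_id M) (@colin_id_subproof M).

Lemma colin_comp_linear (M N P : comodule) (g : colinear N P)
  (f : colinear M N) : linear (fun m => g (f m)).
Proof. by move=> a x y; rewrite !linearP. Qed.

Lemma colin_comp_subproof (M N P : comodule) (g : colinear N P)
  (f : colinear M N) m : coact P (g (f m)) = emap (fun x => g (f x)) (coact M m).
Proof. by rewrite colin_coact colin_coact emap_comp. Qed.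

Definition colin_comp (M N P : comodule) (g : colinear N P) (f : colinear M N) :
    colinear M P :=
  Colinear (colin_comp_linear g f) (colin_comp_subproof g f).

(* The unit object R[1]. *)
Section UnitComodule.

Definition unit_mod : lmodType R := R^o.
Definition unit_coact (r : unit_mod) : unit_mod:oxH := (1 : unit_mod) \oxh t r.

Lemma unit_coact_linear : linear unit_coact.
Proof.
move=> a x y; rewrite /unit_coact rmorphD /= rmorphM epureDr.
by rewrite epure_scale.
Qed.
HB.instance Definition _ :=
  GRing.isLinear.Build R _ _ _ unit_coact unit_coact_linear.

Lemma unit_coact_cou r : ext_cou (unit_coact r) = r.
Proof. by rewrite ext_couE cou_tgt -[_ *: _]/(_ * _) mulr1. Qed.

Lemma com_tgt r : com H (t r) = (1 : resc t) \oxh t r.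
Proof.
rewrite -[in LHS](mulr1 (t r)) -[t r * 1]/(r *: (1 : resc t)) linearZ /= com1.
by rewrite epure_scale mulr1.
Qed.

Lemma unit_coactA r :
  emap unit_coact (unit_coact r) = ext_com (com H) (unit_coact r).
Proof.
rewrite emapE ext_comE com_tgt tliftE; last exact: ext_com_bal1.
by rewrite /= /unit_coact (rmorph1 t).
Qed.

Definition unit_comod : comodule := Comodule unit_coact_cou unit_coactA.
End UnitComodule.

(* M \ox_R N with the codiagonal coaction m \ox n |-> m_0 \ox n_0 \ox m_1 n_1. *)
Section TensorComodule.

Definition cotens (M N : lmodType R) (x : M:oxH) (y : N:oxH) :
    (tens M N):oxH :=
  tens2 (@tpure R M N) (fun h k : resc s => h * k) x y.

Section CotensTheory.
Variables M N : lmodType R.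

Lemma cotensE (m : M) (n : N) h k :
  cotens (m \oxh h) (n \oxh k) = (m \ox n) \oxh (h * k).
Proof.
by apply: tens2E; [apply: bilin_tpure | apply: resc_mul_bilin].
Qed.

Lemma cotensDl (x x' : M:oxH) (y : N:oxH) :
  cotens (x + x') y = cotens x y + cotens x' y.
Proof.
by apply: tens2Dl; [apply: bilin_tpure | apply: resc_mul_bilin].
Qed.

Lemma cotensDr (x : M:oxH) (y y' : N:oxH) :
  cotens x (y + y') = cotens x y + cotens x y'.
Proof.
by apply: tens2Dr; [apply: bilin_tpure | apply: resc_mul_bilin].
Qed.

(* R acts on both sides through t here. *)
Lemma cotens_bilin : bilin (@cotens M N).
Proof.
split; [exact: cotensDl|exact: cotensDr| |] => a x y.
  elim/ext_ind: x => [m h|x x' IHx IHx']; last first.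
    by rewrite scalerDr !cotensDl IHx IHx' scalerDr.
  elim/ext_ind: y => [n k|y y' IHy IHy']; last first.
    by rewrite !cotensDr IHy IHy' scalerDr.
  by rewrite epure_scale !cotensE epure_scale mulrA.
elim/ext_ind: x => [m h|x x' IHx IHx']; last first.
  by rewrite !cotensDl IHx IHx' scalerDr.
elim/ext_ind: y => [n k|y y' IHy IHy']; last first.
  by rewrite scalerDr !cotensDr IHy IHy' scalerDr.
by rewrite epure_scale !cotensE epure_scale mulrCA.
Qed.
End CotensTheory.

Lemma emap_cotens (M N M' N' : lmodType R) (f : {linear M -> M'})
    (g : {linear N -> N'}) (x : M:oxH) (y : N:oxH) :
  emap (tmap f g) (cotens x y) = cotens (emap f x) (emap g y).
Proof.
elim/ext_ind: x => [m h|x x' IHx IHx']; last first.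
  by rewrite !(cotensDl, linearD) /= IHx IHx'.
elim/ext_ind: y => [n k|y y' IHy IHy']; last first.
  by rewrite !(cotensDr, linearD) /= IHy IHy'.
by rewrite !emapE /= !cotensE emapE /= tmapE.
Qed.

Variables M N : comodule.

Definition tens_coact (x : tens M N) : (tens M N):oxH :=
  tlift (fun m n => cotens (coact M m) (coact N n)) x.

Lemma tens_coact_bal :
  balanced (fun m n => cotens (coact M m) (coact N n)).
Proof.
have [Dl Dr Zl Zr] := @cotens_bilin M N.
by split=> *; rewrite ?linearD ?linearZ ?Dl ?Dr ?Zl ?Zr.
Qed.

Lemma tens_coactE m n : tens_coact (m \ox n) = cotens (coact M m) (coact N n).
Proof. exact: (tliftE tens_coact_bal). Qed.

Lemma tens_coact_linear : linear tens_coact.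
Proof.
move=> a x y; rewrite /tens_coact tliftD ?tliftZ //; try exact: tens_coact_bal.
by move=> b m n; rewrite linearZ (bilZl (@cotens_bilin M N)).
Qed.
HB.instance Definition _ :=
  GRing.isLinear.Build R _ _ _ tens_coact tens_coact_linear.

Lemma tens_coact_cou x : ext_cou (tens_coact x) = x.
Proof.
elim/tens_ind: x => [m n|x y IHx IHy]; last by rewrite !linearD /= IHx IHy.
rewrite tens_coactE -[in RHS](coact_cou m) -[in RHS](coact_cou n).
elim/ext_ind: (coact M m) => [m' h|x x' IHx IHx']; last first.
  by rewrite cotensDl !linearD tpureDl /= IHx IHx'.
elim/ext_ind: (coact N n) => [n' k|y y' IHy IHy']; last first.
  by rewrite cotensDr !linearD tpureDr /= IHy IHy'.
by rewrite cotensE !ext_couE rmorphM tpureZl tpureZr scalerA.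
Qed.

(* The codiagonal at the level of (M :oxH) :oxH. *)
Let cotens' (x : M:oxH:oxH) (y : N:oxH:oxH) : (tens M N):oxH:oxH :=
  tens2 (@cotens M N) (fun h k : resc s => h * k) x y.

Let cotens'E (x : M:oxH) (y : N:oxH) h k :
  cotens' (x \oxh h) (y \oxh k) = cotens x y \oxh (h * k).
Proof. by apply: tens2E; [apply: cotens_bilin|apply: resc_mul_bilin]. Qed.

Let cotens'Dl x x' y : cotens' (x + x') y = cotens' x y + cotens' x' y.
Proof. by apply: tens2Dl; [apply: cotens_bilin|apply: resc_mul_bilin]. Qed.

Let cotens'Dr x y y' : cotens' x (y + y') = cotens' x y + cotens' x y'.
Proof. by apply: tens2Dr; [apply: cotens_bilin|apply: resc_mul_bilin]. Qed.

Let emap_tens_coact (x : M:oxH) (y : N:oxH) :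
  emap tens_coact (cotens x y) = cotens' (emap (coact M) x) (emap (coact N) y).
Proof.
elim/ext_ind: x => [m h|x x' IHx IHx']; last first.
  by rewrite !(cotensDl, linearD) /= IHx IHx' cotens'Dl.
elim/ext_ind: y => [n k|y y' IHy IHy']; last first.
  by rewrite !(cotensDr, linearD) /= IHy IHy' cotens'Dr.
by rewrite !emapE !cotensE emapE /= tens_coactE cotens'E.
Qed.

Let ext_com_cotens (x : M:oxH) (y : N:oxH) :
  ext_com (com H) (cotens x y) =
    cotens' (ext_com (com H) x) (ext_com (com H) y).
Proof.
have b := ext_com_bal1; have rb := resc_mul_bilin.
elim/ext_ind: x => [m h|x x' IHx IHx']; last first.
  by rewrite !(cotensDl, ext_comD) IHx IHx' cotens'Dl.
elim/ext_ind: y => [n k|y y' IHy IHy']; last first.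
  by rewrite !(cotensDr, ext_comD) IHy IHy' cotens'Dr.
rewrite cotensE !ext_comE comM.
elim/ext_ind: (com H h) => [h1 h2|x x' IHx IHx']; last first.
  by rewrite tens2Dl ?tliftD // IHx IHx' cotens'Dl.
elim/ext_ind: (com H k) => [k1 k2|y y' IHy IHy']; last first.
  by rewrite tens2Dr ?tliftD // IHy IHy' cotens'Dr.
by rewrite tens2E // !tliftE // cotens'E cotensE.
Qed.

Lemma tens_coactA x :
  emap tens_coact (tens_coact x) = ext_com (com H) (tens_coact x).
Proof.
elim/tens_ind: x => [m n|x y IHx IHy]; last first.
  by rewrite !linearD /= IHx IHy ext_comD.
by rewrite tens_coactE emap_tens_coact ext_com_cotens !coactA.
Qed.

Definition tens_comod : comodule := Comodule tens_coact_cou tens_coactA.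
End TensorComodule.

End Comodules.

(* Categories, with Leibniz equality of morphisms. *)
Record category := Category {
  obj :> Type;
  hom : obj -> obj -> Type;
  idm : forall X, hom X X;
  compm : forall X Y Z, hom Y Z -> hom X Y -> hom X Z;
  comp1m : forall X Y (f : hom X Y), compm (idm Y) f = f;
  compm1 : forall X Y (f : hom X Y), compm f (idm X) = f;
  compmA : forall X Y Z T (f : hom X Y) (g : hom Y Z) (h : hom Z T),
    compm h (compm g f) = compm (compm h g) f }.

Definition is_mono (C : category) (X Y : C) (f : hom X Y) : Prop :=
  forall (Z : C) (g h : hom Z X), compm f g = compm f h -> g = h.

Definition is_iso (C : category) (X Y : C) (f : hom X Y) : Prop :=
  exists g : hom Y X, compm g f = idm X /\ compm f g = idm Y.

Definition is_generator (C : category) (X : C) : Prop :=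
  forall (Y Z : C) (f g : hom Y Z),
    (forall h : hom X Y, compm f h = compm g h) -> f = g.

Record functor (C D : category) := Functor {
  fobj :> C -> D;
  fmap : forall X Y : C, hom X Y -> hom (fobj X) (fobj Y);
  fmap1 : forall X : C, fmap (idm X) = idm (fobj X);
  fmapM : forall (X Y Z : C) (g : hom Y Z) (f : hom X Y),
    fmap (compm g f) = compm (fmap g) (fmap f) }.

Definition functor_id (C : category) : functor C C :=
  @Functor C C id (fun X Y f => f) (fun X => erefl) (fun X Y Z g f => erefl).

Lemma functor_comp1 (C D E : category) (G : functor D E) (F : functor C D)
  (X : C) : fmap G (fmap F (idm X)) = idm (G (F X)).
Proof. by rewrite !fmap1. Qed.

Lemma functor_compM (C D E : category) (G : functor D E) (F : functor C D)
    (X Y Z : C) (g : hom Y Z) (f : hom X Y) :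
  fmap G (fmap F (compm g f)) = compm (fmap G (fmap F g)) (fmap G (fmap F f)).
Proof. by rewrite !fmapM. Qed.

Definition functor_comp (C D E : category) (G : functor D E)
    (F : functor C D) : functor C E :=
  @Functor C E (fun X => G (F X)) (fun X Y f => fmap G (fmap F f))
    (functor_comp1 G F) (functor_compM G F).

Definition nat_isomorphic (C D : category) (F G : functor C D) : Prop :=
  exists eta : forall X : C, hom (F X) (G X),
    (forall X, is_iso (eta X)) /\
    (forall (X Y : C) (f : hom X Y),
      compm (eta Y) (fmap F f) = compm (fmap G f) (eta X)).

Definition is_equivalence (C D : category) (F : functor C D) : Prop :=
  exists G : functor D C,
    nat_isomorphic (functor_comp G F) (functor_id C) /\
    nat_isomorphic (functor_comp F G) (functor_id D).

Section ComoduleCategory.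
Variables (R : comPzRingType) (H : hopf_algebroid R).
Implicit Types M N P : comodule H.

Lemma colin_comp1 M N (f : colinear M N) : colin_comp (colin_id N) f = f.
Proof. exact: colinearP. Qed.
Lemma colin_1comp M N (f : colinear M N) : colin_comp f (colin_id M) = f.
Proof. exact: colinearP. Qed.
Lemma colin_compA M N P Q (f : colinear M N) (g : colinear N P)
  (h : colinear P Q) : colin_comp h (colin_comp g f) =
    colin_comp (colin_comp h g) f.
Proof. exact: colinearP. Qed.

Definition Comod : category :=
  @Category (comodule H) (@colinear R H) (@colin_id R H) (@colin_comp R H)
    colin_comp1 colin_1comp colin_compA.

Local Notation s := (src H).
Local Notation t := (tgt H).

Lemma tlift_linear (M N P : lmodType R) (b : M -> N -> P) :
  bilin b -> linear (tlift b).
Proof.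
move=> bP; have bb := bilin_balanced bP => a x y.
by rewrite tliftD // tliftZ //; case: bP.
Qed.

Lemma tmap_colin (M M' N N' : comodule H) (f : colinear M M')
    (g : colinear N N') (x : tens M N) :
  coact (tens_comod M' N') (tmap f g x) =
    emap (tmap f g) (coact (tens_comod M N) x).
Proof.
rewrite /=; elim/tens_ind: x => [m n|x y IHx IHy]; last first.
  by rewrite !linearD /= IHx IHy.
by rewrite tmapE !tens_coactE emap_cotens !colin_coact.
Qed.

Definition tens_mor (M M' N N' : comodule H) (f : colinear M M')
    (g : colinear N N') : colinear (tens_comod M N) (tens_comod M' N') :=
  @Colinear R H (tens_comod M N) (tens_comod M' N') (tmap f g)
    (@linearP _ _ _ _ _) (tmap_colin f g).

Section Associator.
Variables M N P : lmodType R.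

Lemma assoc_bilin1 (p : P) : bilin (fun (m : M) (n : N) => m \ox (n \ox p)).
Proof.
by split=> *; rewrite ?(tpureDl, tpureDr, tpureZl, tpureZr).
Qed.

Definition assoc_fun : tens (tens M N) P -> tens M (tens N P) :=
  tlift (fun x p => tlift (fun m n => m \ox (n \ox p)) x).

Lemma assoc_bilin :
  bilin (fun (x : tens M N) (p : P) => tlift (fun m n => m \ox (n \ox p)) x).
Proof.
have b p := tlift_linear (assoc_bilin1 p).
have bb p := bilin_balanced (assoc_bilin1 p).
split=> [x x' p|x p p'|a x p|a x p].
- by rewrite tliftD.
- elim/tens_ind: x => [m n|x y IHx IHy]; first by rewrite !tliftE // !tpureDr.
  by rewrite !tliftD // IHx IHy addrACA.
- by rewrite tliftZ // => *; rewrite tpureZl.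
- elim/tens_ind: x => [m n|x y IHx IHy]; first by rewrite !tliftE // !tpureZr.
  by rewrite !tliftD // IHx IHy scalerDr.
Qed.

HB.instance Definition _ :=
  GRing.isLinear.Build R _ _ _ assoc_fun (tlift_linear assoc_bilin).

Lemma assoc_funE m n p : assoc_fun ((m \ox n) \ox p) = m \ox (n \ox p).
Proof.
rewrite /assoc_fun tliftE; last exact/bilin_balanced/assoc_bilin.
by rewrite tliftE //; apply/bilin_balanced/assoc_bilin1.
Qed.

Lemma unassoc_bilin1 (m : M) : bilin (fun (n : N) (p : P) => (m \ox n) \ox p).
Proof.
by split=> *; rewrite ?(tpureDl, tpureDr, tpureZl, tpureZr).
Qed.

Definition unassoc_fun : tens M (tens N P) -> tens (tens M N) P :=
  tlift (fun m y => tlift (fun n p => (m \ox n) \ox p) y).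

Lemma unassoc_bilin :
  bilin (fun (m : M) (y : tens N P) => tlift (fun n p => (m \ox n) \ox p) y).
Proof.
have bb p := bilin_balanced (unassoc_bilin1 p).
split=> [m m' x|m x x'|a m x|a m x].
- elim/tens_ind: x => [n p|x y IHx IHy]; first by rewrite !tliftE // !tpureDl.
  by rewrite !tliftD // IHx IHy addrACA.
- by rewrite tliftD.
- elim/tens_ind: x => [n p|x y IHx IHy]; first by rewrite !tliftE // !tpureZl.
  by rewrite !tliftD // IHx IHy scalerDr.
- by rewrite tliftZ // => *; rewrite tpureZr tpureZl.
Qed.

HB.instance Definition _ :=
  GRing.isLinear.Build R _ _ _ unassoc_fun (tlift_linear unassoc_bilin).

Lemma unassoc_funE m n p : unassoc_fun (m \ox (n \ox p)) = (m \ox n) \ox p.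
Proof.
rewrite /unassoc_fun tliftE; last exact/bilin_balanced/unassoc_bilin.
by rewrite tliftE //; apply/bilin_balanced/unassoc_bilin1.
Qed.

Definition flip_fun : tens M N -> tens N M := tlift (fun m n => n \ox m).

Lemma flip_bilin : bilin (fun (m : M) (n : N) => n \ox m).
Proof.
by split=> *; rewrite ?(tpureDl, tpureDr, tpureZl, tpureZr).
Qed.
HB.instance Definition _ :=
  GRing.isLinear.Build R _ _ _ flip_fun (tlift_linear flip_bilin).

Lemma flip_funE m n : flip_fun (m \ox n) = n \ox m.
Proof. exact/tliftE/bilin_balanced/flip_bilin. Qed.
End Associator.

Lemma tens3_ind (M N P : lmodType R) (Q : tens (tens M N) P -> Prop) :
    (forall m n p, Q ((m \ox n) \ox p)) ->
    (forall x y, Q x -> Q y -> Q (x + y)) ->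
  forall x, Q x.
Proof.
move=> Qp QD; elim/tens_ind => [z p|x y]; last exact: QD.
by elim/tens_ind: z => // x y; rewrite tpureDl; apply: QD.
Qed.

Lemma tens3r_ind (M N P : lmodType R) (Q : tens M (tens N P) -> Prop) :
    (forall m n p, Q (m \ox (n \ox p))) ->
    (forall x y, Q x -> Q y -> Q (x + y)) ->
  forall x, Q x.
Proof.
move=> Qp QD; elim/tens_ind => [m z|x y]; last exact: QD.
by elim/tens_ind: z => // x y; rewrite tpureDr; apply: QD.
Qed.

Section AssociatorComod.
Variables M N P : comodule H.

Lemma assoc_cotens (x : ext s t M) (y : ext s t N) (z : ext s t P) :
  emap (@assoc_fun M N P) (cotens (cotens x y) z) = cotens x (cotens y z).
Proof.
elim/ext_ind: x => [m h|x x' IHx IHx']; last first.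
  by rewrite !(cotensDl, linearD) /= IHx IHx'.
elim/ext_ind: y => [n k|y y' IHy IHy']; last first.
  by rewrite !(cotensDl, cotensDr, linearD) /= IHy IHy'.
elim/ext_ind: z => [p l|z z' IHz IHz']; last first.
  by rewrite !(cotensDr, linearD) /= IHz IHz'.
by rewrite !cotensE emapE /= assoc_funE mulrA.
Qed.

Lemma unassoc_cotens (x : ext s t M) (y : ext s t N) (z : ext s t P) :
  emap (@unassoc_fun M N P) (cotens x (cotens y z)) = cotens (cotens x y) z.
Proof.
elim/ext_ind: x => [m h|x x' IHx IHx']; last first.
  by rewrite !(cotensDl, linearD) /= IHx IHx'.
elim/ext_ind: y => [n k|y y' IHy IHy']; last first.
  by rewrite !(cotensDl, cotensDr, linearD) /= IHy IHy'.
elim/ext_ind: z => [p l|z z' IHz IHz']; last first.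
  by rewrite !(cotensDr, linearD) /= IHz IHz'.
by rewrite !cotensE emapE /= unassoc_funE mulrA.
Qed.

Lemma flip_cotens (x : ext s t M) (y : ext s t N) :
  emap (@flip_fun M N) (cotens x y) = cotens y x.
Proof.
elim/ext_ind: x => [m h|x x' IHx IHx']; last first.
  by rewrite !(cotensDl, cotensDr, linearD) /= IHx IHx'.
elim/ext_ind: y => [n k|y y' IHy IHy']; last first.
  by rewrite !(cotensDl, cotensDr, linearD) /= IHy IHy'.
by rewrite !cotensE emapE /= flip_funE mulrC.
Qed.

Lemma assoc_colin x :
  coact (tens_comod M (tens_comod N P)) (@assoc_fun M N P x) =
    emap (@assoc_fun M N P) (coact (tens_comod (tens_comod M N) P) x).
Proof.
rewrite /=; elim/tens3_ind: x => [m n p|x y IHx IHy]; last first.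
  by rewrite !linearD /= IHx IHy.
by rewrite assoc_funE !tens_coactE /= !tens_coactE assoc_cotens.
Qed.

Lemma unassoc_colin x :
  coact (tens_comod (tens_comod M N) P) (@unassoc_fun M N P x) =
    emap (@unassoc_fun M N P) (coact (tens_comod M (tens_comod N P)) x).
Proof.
rewrite /=; elim/tens3r_ind: x => [m n p|x y IHx IHy]; last first.
  by rewrite !linearD /= IHx IHy.
by rewrite unassoc_funE !tens_coactE /= !tens_coactE unassoc_cotens.
Qed.

Lemma flip_colin x :
  coact (tens_comod N M) (@flip_fun M N x) =
    emap (@flip_fun M N) (coact (tens_comod M N) x).
Proof.
rewrite /=; elim/tens_ind: x => [m n|x y IHx IHy]; last first.
  by rewrite !linearD /= IHx IHy.
by rewrite flip_funE !tens_coactE flip_cotens.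
Qed.

Definition assoc :
    colinear (tens_comod (tens_comod M N) P) (tens_comod M (tens_comod N P)) :=
  @Colinear R H (tens_comod (tens_comod M N) P) (tens_comod M (tens_comod N P))
    (@assoc_fun M N P) (tlift_linear (@assoc_bilin M N P)) assoc_colin.

Definition unassoc :
    colinear (tens_comod M (tens_comod N P)) (tens_comod (tens_comod M N) P) :=
  @Colinear R H (tens_comod M (tens_comod N P)) (tens_comod (tens_comod M N) P)
    (@unassoc_fun M N P) (tlift_linear (@unassoc_bilin M N P)) unassoc_colin.

Definition flip : colinear (tens_comod M N) (tens_comod N M) :=
  @Colinear R H (tens_comod M N) (tens_comod N M)
    (@flip_fun M N) (tlift_linear (@flip_bilin M N)) flip_colin.
End AssociatorComod.

Section Unitor.
Variable M : comodule H.
Local Notation "1c" := (unit_comod H).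

Definition lunit_fun : tens (unit_mod R) M -> M :=
  tlift (fun (r : unit_mod R) m => (r : R) *: m).

Lemma lunit_bilin : bilin (fun (r : unit_mod R) (m : M) => (r : R) *: m).
Proof.
split=> [r r' m|r m m'|a r m|a r m].
- exact: scalerDl.
- exact: scalerDr.
- by rewrite scalerA.
- by rewrite !scalerA mulrC.
Qed.
HB.instance Definition _ :=
  GRing.isLinear.Build R _ _ _ lunit_fun (tlift_linear lunit_bilin).

Lemma lunit_funE (r : R) m : lunit_fun ((r : unit_mod R) \ox m) = r *: m.
Proof. exact: (tliftE (bilin_balanced lunit_bilin)). Qed.

Lemma lunit_colin x :
  coact M (lunit_fun x) = emap lunit_fun (coact (tens_comod 1c M) x).
Proof.
rewrite /=; elim/tens_ind: x => [r m|x y IHx IHy]; last first.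
  by rewrite !linearD /= IHx IHy.
rewrite lunit_funE tens_coactE linearZ /=.
elim/ext_ind: (coact M m) => [n h|x y IHx IHy]; last first.
  by rewrite scalerDr cotensDr linearD IHx IHy.
by rewrite cotensE emapE /= lunit_funE scale1r epure_scale.
Qed.

Definition lunit : colinear (tens_comod 1c M) M :=
  @Colinear R H (tens_comod 1c M) M
    lunit_fun (tlift_linear lunit_bilin) lunit_colin.

Definition unlunit_fun (m : M) : tens (unit_mod R) M := (1 : unit_mod R) \ox m.

Lemma unlunit_linear : linear unlunit_fun.
Proof. by move=> a x y; rewrite /unlunit_fun tpureDr tpureZr. Qed.
HB.instance Definition _ :=
  GRing.isLinear.Build R _ _ _ unlunit_fun unlunit_linear.

Lemma unlunit_colin m :
  coact (tens_comod 1c M) (unlunit_fun m) = emap unlunit_fun (coact M m).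
Proof.
rewrite /= tens_coactE /= /unit_coact.
elim/ext_ind: (coact M m) => [n h|x y IHx IHy]; last first.
  by rewrite cotensDr linearD IHx IHy.
by rewrite cotensE emapE (rmorph1 t) mul1r.
Qed.

Definition unlunit : colinear M (tens_comod 1c M) :=
  @Colinear R H M (tens_comod 1c M) unlunit_fun unlunit_linear unlunit_colin.
End Unitor.

End ComoduleCategory.

(* Groups. The library's groupType is not used because its carriers are
   choiceTypes, whose universe is too small for the type of isomorphism classes
   of monomorphisms of comodules. *)
Record group := Group {
  group_car :> Type;
  gmul : group_car -> group_car -> group_car;
  gone : group_car;
  ginv : group_car -> group_car;
  gmulA : associative gmul;
  gmul1 : left_id gone gmul;
  gmulr1 : right_id gone gmul;
  gmulV : left_inverse gone ginv gmul;
  gmulrV : right_inverse gone ginv gmul }.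

Definition group_isomorphic (G K : group) : Prop :=
  exists phi : G -> K,
    bijective phi /\ {morph phi : x y / gmul x y >-> gmul x y}.

Section ComoduleAlgebras.
Variables (R : comPzRingType) (H : hopf_algebroid R).
Local Notation "1c" := (unit_comod H).
Local Notation "M \oxc N" := (tens_comod M N) (at level 40, left associativity).

(* Monoids in Comod H; the diagrams are spelled out on pure tensors, which
   generate the tensor products. *)
Record comod_alg := ComodAlg {
  alg_comod :> comodule H;
  alg_mul : colinear (alg_comod \oxc alg_comod) alg_comod;
  alg_one : colinear 1c alg_comod;
  alg_mulA : forall a b c,
    alg_mul (alg_mul (a \ox b) \ox c) = alg_mul (a \ox alg_mul (b \ox c));
  alg_mul1l : forall (r : R) a, alg_mul (alg_one r \ox a) = r *: a;
  alg_mul1r : forall (r : R) a, alg_mul (a \ox alg_one r) = r *: a }.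

Variable A : comod_alg.
Local Notation m := (alg_mul A).
Local Notation u := (alg_one A).

(* A-bimodules in Comod H, that is, left modules over A \ox_R A^o. *)
Record bimod := Bimod {
  bimod_comod :> comodule H;
  lact : colinear (A \oxc bimod_comod) bimod_comod;
  ract : colinear (bimod_comod \oxc A) bimod_comod;
  lact1 : forall x, lact (u (1 : R) \ox x) = x;
  lactA : forall a b x, lact (m (a \ox b) \ox x) = lact (a \ox lact (b \ox x));
  ract1 : forall x, ract (x \ox u (1 : R)) = x;
  ractA : forall x a b, ract (x \ox m (a \ox b)) = ract (ract (x \ox a) \ox b);
  lractA : forall a x b,
    ract (lact (a \ox x) \ox b) = lact (a \ox ract (x \ox b)) }.

Record bimod_hom (M N : bimod) := BimodHom {
  bimod_fun :> colinear M N;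
  bimod_lact : forall a x,
    bimod_fun (lact M (a \ox x)) = lact N (a \ox bimod_fun x);
  bimod_ract : forall x a,
    bimod_fun (ract M (x \ox a)) = ract N (bimod_fun x \ox a) }.

Lemma bimod_homP (M N : bimod) (f g : bimod_hom M N) : f =1 g -> f = g.
Proof.
case: f g => [f fl fr] [g gl gr] /= /colinearP fg; subst g.
by congr BimodHom; apply: Prop_irrelevance.
Qed.

Definition bimod_id (M : bimod) : bimod_hom M M :=
  @BimodHom M M (colin_id M) (fun a x => erefl) (fun x a => erefl).

Lemma bimod_comp_l (M N P : bimod) (g : bimod_hom N P) (f : bimod_hom M N) a x :
  colin_comp g f (lact M (a \ox x)) = lact P (a \ox colin_comp g f x).
Proof. by rewrite /= !bimod_lact. Qed.

Lemma bimod_comp_r (M N P : bimod) (g : bimod_hom N P) (f : bimod_hom M N) x a :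
  colin_comp g f (ract M (x \ox a)) = ract P (colin_comp g f x \ox a).
Proof. by rewrite /= !bimod_ract. Qed.

Definition bimod_comp (M N P : bimod) (g : bimod_hom N P) (f : bimod_hom M N) :
    bimod_hom M P :=
  BimodHom (bimod_comp_l g f) (bimod_comp_r g f).

Lemma bimod_comp1m M N (f : bimod_hom M N) : bimod_comp (bimod_id N) f = f.
Proof. exact: bimod_homP. Qed.
Lemma bimod_compm1 M N (f : bimod_hom M N) : bimod_comp f (bimod_id M) = f.
Proof. exact: bimod_homP. Qed.
Lemma bimod_compA M N P Q (f : bimod_hom M N) (g : bimod_hom N P)
  (h : bimod_hom P Q) :
  bimod_comp h (bimod_comp g f) = bimod_comp (bimod_comp h g) f.
Proof. exact: bimod_homP. Qed.

Definition Bimods : category :=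
  @Category bimod bimod_hom bimod_id bimod_comp
    bimod_comp1m bimod_compm1 bimod_compA.

Lemma alg_mul1l1 a : m (u (1 : R) \ox a) = a.
Proof. by rewrite alg_mul1l scale1r. Qed.
Lemma alg_mul1r1 a : m (a \ox u (1 : R)) = a.
Proof. by rewrite alg_mul1r scale1r. Qed.

Definition reg_bimod : bimod :=
  @Bimod A m m alg_mul1l1 (@alg_mulA A) alg_mul1r1
    (fun x a b => esym (@alg_mulA A x a b)) (@alg_mulA A).

(* A \ox X with a (c \ox x) b = a c b \ox x. *)
Section InducedBimodule.
Variable X : comodule H.

Definition ind_lact : colinear (A \oxc (A \oxc X)) (A \oxc X) :=
  colin_comp (tens_mor m (colin_id X)) (unassoc A A X).
Definition ind_ract : colinear ((A \oxc X) \oxc A) (A \oxc X) :=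
  colin_comp ind_lact
    (colin_comp (tens_mor (colin_id A) (flip X A)) (assoc A X A)).

Lemma ind_lactE a c (x : X) : ind_lact (a \ox (c \ox x)) = m (a \ox c) \ox x.
Proof. by rewrite /= unassoc_funE (tmapE m idfun). Qed.

Lemma ind_ractE c (x : X) b : ind_ract ((c \ox x) \ox b) = m (c \ox b) \ox x.
Proof.
by rewrite -ind_lactE /= assoc_funE (tmapE idfun (flip X A)) /= flip_funE.
Qed.

Lemma ind_lact1 z : ind_lact (u (1 : R) \ox z) = z.
Proof.
elim/tens_ind: z => [c x|y z IHy IHz]; first by rewrite ind_lactE alg_mul1l1.
by rewrite tpureDr colinD IHy IHz.
Qed.

Lemma ind_lactA a b z :
  ind_lact (m (a \ox b) \ox z) = ind_lact (a \ox ind_lact (b \ox z)).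
Proof.
elim/tens_ind: z => [c x|y z IHy IHz].
  by rewrite !ind_lactE alg_mulA.
by rewrite !(tpureDr, colinD) IHy IHz.
Qed.

Lemma ind_ract1 z : ind_ract (z \ox u (1 : R)) = z.
Proof.
elim/tens_ind: z => [c x|y z IHy IHz]; first by rewrite ind_ractE alg_mul1r1.
by rewrite tpureDl colinD IHy IHz.
Qed.

Lemma ind_ractA z a b :
  ind_ract (z \ox m (a \ox b)) = ind_ract (ind_ract (z \ox a) \ox b).
Proof.
elim/tens_ind: z => [c x|y z IHy IHz].
  by rewrite !ind_ractE alg_mulA.
by rewrite !(tpureDl, colinD) IHy IHz.
Qed.

Lemma ind_lractA a z b :
  ind_ract (ind_lact (a \ox z) \ox b) = ind_lact (a \ox ind_ract (z \ox b)).
Proof.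
elim/tens_ind: z => [c x|y z IHy IHz].
  by rewrite ind_lactE !ind_ractE ind_lactE alg_mulA.
by rewrite !(tpureDl, tpureDr, colinD) IHy IHz.
Qed.

Definition ind_bimod : bimod :=
  @Bimod (A \oxc X) ind_lact ind_ract
    ind_lact1 ind_lactA ind_ract1 ind_ractA ind_lractA.
End InducedBimodule.

Lemma ind_hom_l (X Y : comodule H) (f : colinear X Y) a z :
  tens_mor (colin_id A) f (ind_lact X (a \ox z)) =
    ind_lact Y (a \ox tens_mor (colin_id A) f z).
Proof.
have fE c x : tens_mor (colin_id A) f (c \ox x) = c \ox f x.
  exact: (tmapE idfun f).
elim/tens_ind: z => [c x|y z IHy IHz].
  by rewrite ind_lactE !fE ind_lactE.
by rewrite !(tpureDr, colinD) IHy IHz.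
Qed.

Lemma ind_hom_r (X Y : comodule H) (f : colinear X Y) z a :
  tens_mor (colin_id A) f (ind_ract X (z \ox a)) =
    ind_ract Y (tens_mor (colin_id A) f z \ox a).
Proof.
have fE c x : tens_mor (colin_id A) f (c \ox x) = c \ox f x.
  exact: (tmapE idfun f).
elim/tens_ind: z => [c x|y z IHy IHz].
  by rewrite ind_ractE !fE ind_ractE.
by rewrite !(tpureDl, colinD) IHy IHz.
Qed.

Definition ind_hom (X Y : comodule H) (f : colinear X Y) :
    bimod_hom (ind_bimod X) (ind_bimod Y) :=
  @BimodHom (ind_bimod X) (ind_bimod Y) (tens_mor (colin_id A) f)
    (ind_hom_l f) (ind_hom_r f).

Lemma ind_homE (X Y : comodule H) (f : colinear X Y) a x :
  ind_hom f (a \ox x) = a \ox f x.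
Proof. exact: (tmapE idfun f). Qed.

Lemma ind_hom1 (X : comodule H) : ind_hom (colin_id X) = bimod_id (ind_bimod X).
Proof.
apply: bimod_homP; elim/tens_ind => [a x|y z IHy IHz]; first exact: ind_homE.
by rewrite !colinD IHy IHz.
Qed.

Lemma ind_homM (X Y Z : comodule H) (g : colinear Y Z) (f : colinear X Y) :
  ind_hom (colin_comp g f) = bimod_comp (ind_hom g) (ind_hom f).
Proof.
apply: bimod_homP; elim/tens_ind => [a x|y z IHy IHz].
  rewrite ind_homE; apply: esym.
  by apply: etrans (congr1 (ind_hom g) (ind_homE f a x)) _; exact: ind_homE.
by rewrite !colinD IHy IHz.
Qed.

Definition ind_functor : functor (Comod H) Bimods :=
  @Functor (Comod H) Bimods ind_bimod ind_hom ind_hom1 ind_homM.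

(* A \ox A with a (b \ox c) d = a b \ox c d. *)
Definition outer_ract : colinear ((A \oxc A) \oxc A) (A \oxc A) :=
  colin_comp (tens_mor (colin_id A) m) (assoc A A A).

Lemma outer_ractE b c d : outer_ract ((b \ox c) \ox d) = b \ox m (c \ox d).
Proof. by rewrite /= assoc_funE (tmapE idfun m). Qed.

Lemma outer_ract1 z : outer_ract (z \ox u (1 : R)) = z.
Proof.
elim/tens_ind: z => [b c|y z IHy IHz]; first by rewrite outer_ractE alg_mul1r1.
by rewrite tpureDl colinD IHy IHz.
Qed.

Lemma outer_ractA z a b :
  outer_ract (z \ox m (a \ox b)) = outer_ract (outer_ract (z \ox a) \ox b).
Proof.
elim/tens_ind: z => [c d|y z IHy IHz].
  by rewrite !outer_ractE alg_mulA.
by rewrite !(tpureDl, colinD) IHy IHz.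
Qed.

Lemma outer_lractA a z b :
  outer_ract (ind_lact A (a \ox z) \ox b) =
    ind_lact A (a \ox outer_ract (z \ox b)).
Proof.
elim/tens_ind: z => [c d|y z IHy IHz].
  by rewrite ind_lactE !outer_ractE ind_lactE.
by rewrite !(tpureDl, tpureDr, colinD) IHy IHz.
Qed.

Definition outer_bimod : bimod :=
  @Bimod (A \oxc A) (ind_lact A) outer_ract
    (@ind_lact1 A) (@ind_lactA A) outer_ract1 outer_ractA outer_lractA.

Lemma mul_hom_l a z : m (ind_lact A (a \ox z)) = m (a \ox m z).
Proof.
elim/tens_ind: z => [c d|y z IHy IHz]; first by rewrite ind_lactE alg_mulA.
by rewrite !(tpureDr, colinD) IHy IHz.
Qed.

Lemma mul_hom_r z a : m (outer_ract (z \ox a)) = m (m z \ox a).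
Proof.
elim/tens_ind: z => [c d|y z IHy IHz]; first by rewrite outer_ractE alg_mulA.
by rewrite !(tpureDl, colinD) IHy IHz.
Qed.

Definition mul_hom : bimod_hom outer_bimod reg_bimod :=
  @BimodHom outer_bimod reg_bimod m mul_hom_l mul_hom_r.

Definition azumaya : Prop :=
  is_equivalence ind_functor /\
  exists sigma : bimod_hom reg_bimod outer_bimod,
    bimod_comp mul_hom sigma = bimod_id reg_bimod.

(* M | N. *)
Definition bimod_divides (M N : bimod) : Prop :=
  exists (k : nat) (f : 'I_k -> bimod_hom M N) (g : 'I_k -> bimod_hom N M),
    (0 < k)%N /\ forall x, \sum_(i < k) g i (f i x) = x.

Record alg_aut := AlgAut {
  aut_fun :> colinear A A;
  aut_inv : colinear A A;
  autM : forall a b, aut_fun (m (a \ox b)) = m (aut_fun a \ox aut_fun b);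
  aut1 : forall r : R, aut_fun (u r) = u r;
  aut_funK : cancel aut_fun aut_inv;
  aut_invK : cancel aut_inv aut_fun }.

Lemma alg_autP (f g : alg_aut) : f =1 g -> f = g.
Proof.
case: f g => [f f' fM f1 fK f'K] [g g' gM g1 gK g'K] /= fg.
have ffg := colinearP fg; subst g.
have fg' : f' = g' by apply: colinearP => x; rewrite -{1}(g'K x) fK.
by subst g'; congr AlgAut; apply: Prop_irrelevance.
Qed.

Definition aut_id : alg_aut :=
  @AlgAut (colin_id A) (colin_id A) (fun a b => erefl) (fun r => erefl)
    (fun x => erefl) (fun x => erefl).

Section AutComp.
Variables f g : alg_aut.

Lemma aut_compM a b :
  colin_comp f g (m (a \ox b)) = m (colin_comp f g a \ox colin_comp f g b).
Proof. by rewrite /= !autM. Qed.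
Lemma aut_comp1 (r : R) : colin_comp f g (u r) = u r.
Proof. by rewrite /= !aut1. Qed.
Lemma aut_compK :
  cancel (colin_comp f g) (colin_comp (aut_inv g) (aut_inv f)).
Proof. by move=> x; rewrite /= !aut_funK. Qed.
Lemma aut_compK' :
  cancel (colin_comp (aut_inv g) (aut_inv f)) (colin_comp f g).
Proof. by move=> x; rewrite /= !aut_invK. Qed.
Definition aut_comp : alg_aut := AlgAut aut_compM aut_comp1 aut_compK aut_compK'.

Lemma aut_invM a b : aut_inv f (m (a \ox b)) = m (aut_inv f a \ox aut_inv f b).
Proof. by apply: (can_inj (aut_funK f)); rewrite autM !aut_invK. Qed.
Lemma aut_inv1 (r : R) : aut_inv f (u r) = u r.
Proof. by rewrite -{1}(aut1 f) aut_funK. Qed.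
Definition aut_sym : alg_aut := AlgAut aut_invM aut_inv1 (@aut_invK f) (@aut_funK f).
End AutComp.

Lemma aut_compA : associative aut_comp.
Proof. by move=> f g h; apply: alg_autP. Qed.
Lemma aut_comp1f : left_id aut_id aut_comp.
Proof. by move=> f; apply: alg_autP. Qed.
Lemma aut_compf1 : right_id aut_id aut_comp.
Proof. by move=> f; apply: alg_autP. Qed.
Lemma aut_compVf : left_inverse aut_id aut_sym aut_comp.
Proof. by move=> f; apply: alg_autP => x; rewrite /= aut_funK. Qed.
Lemma aut_compfV : right_inverse aut_id aut_sym aut_comp.
Proof. by move=> f; apply: alg_autP => x; rewrite /= aut_invK. Qed.

Definition aut_group : group := Group
  aut_compA aut_comp1f aut_compf1 aut_compVf aut_compfV.

End ComoduleAlgebras.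

Section Isomorphisms.
Variable C : category.

Lemma iso_id (X : C) : is_iso (idm X).
Proof. by exists (idm X); rewrite comp1m. Qed.

Lemma iso_comp (X Y Z : C) (g : hom Y Z) (f : hom X Y) :
  is_iso g -> is_iso f -> is_iso (compm g f).
Proof.
move=> [g' [g'g gg']] [f' [f'f ff']]; exists (compm f' g'); split.
  by rewrite -compmA [compm g' _]compmA g'g comp1m.
by rewrite -compmA [compm f _]compmA ff' comp1m.
Qed.

Lemma iso_mono (X Y : C) (f : hom X Y) : is_iso f -> is_mono f.
Proof.
move=> [f' [f'f _]] Z g h /(congr1 (compm f')).
by rewrite !compmA f'f !comp1m.
Qed.
End Isomorphisms.

Section InvertibleSubcomodules.
Variables (R : comPzRingType) (H : hopf_algebroid R).
Local Notation "1c" := (unit_comod H).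
Local Notation "M \oxc N" := (tens_comod M N) (at level 40, left associativity).
Local Notation mono i := (@is_mono (Comod H) _ _ i).
Local Notation iso i := (@is_iso (Comod H) _ _ i).

Section IsoLemmas.
Implicit Types M N P : comodule H.

Lemma colin_eq M N (f g : colinear M N) : f = g -> f =1 g.
Proof. by move=> ->. Qed.

Lemma iso_cancel M N (f : colinear M N) (g : colinear N M) :
  cancel f g -> cancel g f -> iso f.
Proof. by move=> fK gK; exists g; split; apply: colinearP. Qed.

Lemma tens_morE M M' N N' (f : colinear M M') (g : colinear N N') x y :
  tens_mor f g (x \ox y) = f x \ox g y.
Proof. exact: (tmapE f g). Qed.

Lemma iso_tens M M' N N' (f : colinear M M') (g : colinear N N') :
  iso f -> iso g -> iso (tens_mor f g).
Proof.
move=> [f' [f'f ff']] [g' [g'g gg']].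
have fK x : f' (f x) = x by exact: (colin_eq f'f x).
have f'K x : f (f' x) = x by exact: (colin_eq ff' x).
have gK x : g' (g x) = x by exact: (colin_eq g'g x).
have g'K x : g (g' x) = x by exact: (colin_eq gg' x).
apply: (@iso_cancel _ _ _ (tens_mor f' g')); elim/tens_ind => [x y|x y Ix Iy].
- by rewrite !tens_morE fK gK.
- by rewrite !colinD Ix Iy.
- by rewrite !tens_morE f'K g'K.
- by rewrite !colinD Ix Iy.
Qed.

Lemma assocE M N P (x : M) (y : N) (z : P) :
  assoc M N P ((x \ox y) \ox z) = x \ox (y \ox z).
Proof. exact: assoc_funE. Qed.

Lemma unassocE M N P (x : M) (y : N) (z : P) :
  unassoc M N P (x \ox (y \ox z)) = (x \ox y) \ox z.
Proof. exact: unassoc_funE. Qed.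

Lemma assocK M N P : cancel (assoc M N P) (unassoc M N P).
Proof.
elim/tens3_ind => [x y z|x y Ix Iy]; first by rewrite assocE unassocE.
by rewrite !colinD Ix Iy.
Qed.

Lemma unassocK M N P : cancel (unassoc M N P) (assoc M N P).
Proof.
elim/tens3r_ind => [x y z|x y Ix Iy]; first by rewrite unassocE assocE.
by rewrite !colinD Ix Iy.
Qed.

Lemma flipE M N (x : M) (y : N) : flip M N (x \ox y) = y \ox x.
Proof. exact: flip_funE. Qed.

Lemma flipK M N : cancel (flip M N) (flip N M).
Proof.
by elim/tens_ind => [x y|x y Ix Iy]; rewrite ?flipE // !colinD Ix Iy.
Qed.

Lemma lunitE M (r : R) (x : M) : lunit M ((r : unit_mod R) \ox x) = r *: x.
Proof. exact: lunit_funE. Qed.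

Lemma lunitK M : cancel (lunit M) (unlunit M).
Proof.
elim/tens_ind => [r x|x y Ix Iy]; last by rewrite !colinD Ix Iy.
rewrite lunitE -[unlunit M _]/((1 : unit_mod R) \ox (r *: x)) tpureZr -tpureZl.
by congr (_ \ox _); exact: mulr1.
Qed.

Lemma unlunitK M : cancel (unlunit M) (lunit M).
Proof. by move=> x; rewrite lunitE scale1r. Qed.

Lemma iso_assoc M N P : iso (assoc M N P).
Proof. exact: iso_cancel (@assocK M N P) (@unassocK M N P). Qed.
Lemma iso_unassoc M N P : iso (unassoc M N P).
Proof. exact: iso_cancel (@unassocK M N P) (@assocK M N P). Qed.
Lemma iso_flip M N : iso (flip M N).
Proof. exact: iso_cancel (@flipK M N) (@flipK N M). Qed.
Lemma iso_lunit M : iso (lunit M).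
Proof. exact: iso_cancel (@lunitK M) (@unlunitK M). Qed.
Lemma iso_cid M : iso (colin_id M).
Proof. exact: (@iso_id (Comod H)). Qed.
Lemma iso_ccomp M N P (g : colinear N P) (f : colinear M N) :
  iso g -> iso f -> iso (colin_comp g f).
Proof. exact: (@iso_comp (Comod H)). Qed.
End IsoLemmas.

Section Subcomodules.
Variable A : comod_alg H.
Local Notation m := (alg_mul A).
Local Notation u := (alg_one A).

Definition sub_prod (X Y : comodule H) (i : colinear X A) (j : colinear Y A) :
    colinear (X \oxc Y) A :=
  colin_comp m (tens_mor i j).

Lemma sub_prodE (X Y : comodule H) (i : colinear X A) (j : colinear Y A) x y :
  sub_prod i j (x \ox y) = m (i x \ox j y).
Proof. by rewrite -tens_morE. Qed.

Definition sub_inverse (X Y : comodule H) (i : colinear X A)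
    (j : colinear Y A) : Prop :=
  exists (mX : colinear (X \oxc Y) 1c) (mY : colinear (Y \oxc X) 1c),
    [/\ iso mX, iso mY, colin_comp u mX = sub_prod i j
      & colin_comp u mY = sub_prod j i].

Lemma sub_inverse_sym (X Y : comodule H) (i : colinear X A)
  (j : colinear Y A) : sub_inverse i j -> sub_inverse j i.
Proof. by move=> [mX [mY [? ? ? ?]]]; exists mY, mX. Qed.

Lemma colin_compE (M N P : comodule H) (g : colinear N P) (f : colinear M N) x :
  colin_comp g f x = g (f x).
Proof. by []. Qed.

(* X \ox X' -> A is again a monomorphism when X is invertible. *)
Lemma sub_prod_mono (X Y X' : comodule H) (i : colinear X A)
    (j : colinear Y A) (i' : colinear X' A) :
  sub_inverse i j -> mono i -> mono i' -> mono (sub_prod i i').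
Proof.
move=> [mX [mY [[mX' [_ mXK]] _ eX eY]]] iM i'M T f g efg.
have eX' x y : u (mX (x \ox y)) = m (i x \ox j y).
  by rewrite -sub_prodE -eX.
have eY' y x : u (mY (y \ox x)) = m (j y \ox i x).
  by rewrite -sub_prodE -eY.
pose q : colinear (Y \oxc (X \oxc X')) X' :=
  colin_comp (lunit X')
    (colin_comp (tens_mor mY (colin_id X')) (unassoc Y X X')).
have qE y x x' : q (y \ox (x \ox x')) = (mY (y \ox x) : R) *: x'.
  by rewrite !colin_compE unassocE tens_morE lunitE.
have k1 y z : i' (q (y \ox z)) = m (j y \ox sub_prod i i' z).
  elim/tens_ind: z => [x x'|z z' Iz Iz']; last first.
    by rewrite !(tpureDr, colinD) Iz Iz'.
  by rewrite qE sub_prodE colinZ -alg_mul1l eY' alg_mulA.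
have k2 y t : q (y \ox f t) = q (y \ox g t).
  have e : colin_comp q (tens_mor (colin_id Y) f) =
           colin_comp q (tens_mor (colin_id Y) g).
    apply: i'M; apply: colinearP; elim/tens_ind => [y' t'|z z' Iz Iz'].
      rewrite !colin_compE !tens_morE !k1; congr (m (_ \ox _)).
      exact: (colin_eq efg t').
    by rewrite !colinD Iz Iz'.
  by have := colin_eq e (y \ox t); rewrite !colin_compE !tens_morE.
have k0 x y x1 : (mX (x \ox y) : R) *: x1 = (mY (y \ox x1) : R) *: x.
  pose l : colinear ((X \oxc Y) \oxc X) X :=
    colin_comp (lunit X) (tens_mor mX (colin_id X)).
  pose r : colinear ((X \oxc Y) \oxc X) X :=
    colin_comp (lunit X) (colin_comp (flip X 1c)
      (colin_comp (tens_mor (colin_id X) mY) (assoc X Y X))).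
  have lE : l ((x \ox y) \ox x1) = (mX (x \ox y) : R) *: x1.
    by rewrite !colin_compE tens_morE lunitE.
  have rE : r ((x \ox y) \ox x1) = (mY (y \ox x1) : R) *: x.
    by rewrite !colin_compE assocE tens_morE flipE lunitE.
  rewrite -lE -rE; suff -> : l = r by [].
  apply: iM; apply: colinearP; elim/tens3_ind => [a b c|z z' Iz Iz'].
    rewrite !colin_compE assocE !tens_morE flipE !lunitE !colinZ.
    by rewrite -alg_mul1l -alg_mul1r eX' eY' alg_mulA.
  by rewrite !colinD Iz Iz'.
have k3 x y (z : tens X X') : (mX (x \ox y) : R) *: z = x \ox q (y \ox z).
  elim/tens_ind: z => [x1 x'|z z' Iz Iz']; last first.
    by rewrite !(tpureDr, colinD) -Iz -Iz' scalerDr.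
  by rewrite qE -tpureZl k0 tpureZr tpureZl.
apply: colinearP => t.
have k4 (w : tens X Y) : (mX w : R) *: f t = (mX w : R) *: g t.
  elim/tens_ind: w => [x y|w w' Iw Iw']; first by rewrite !k3 k2.
  have mXD : (mX (w + w') : R) = (mX w : R) + (mX w' : R) := colinD mX w w'.
  by rewrite mXD !scalerDl Iw Iw'.
have := k4 (mX' (1 : R)).
have -> : mX (mX' (1 : R)) = 1 :> R.
  exact: (colin_eq mXK (1 : R)).
by rewrite !scale1r.
Qed.

Lemma sub_contract (X Y X' Y' : comodule H) (i : colinear X A)
    (j : colinear Y A) (i' : colinear X' A) (j' : colinear Y' A)
    (mX : colinear (X \oxc Y) 1c) (mX' : colinear (X' \oxc Y') 1c) :
    iso mX -> iso mX' -> colin_comp u mX = sub_prod i j ->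
    colin_comp u mX' = sub_prod i' j' ->
  exists n : colinear ((X \oxc X') \oxc (Y' \oxc Y)) 1c,
    iso n /\ colin_comp u n = sub_prod (sub_prod i i') (sub_prod j' j).
Proof.
move=> iX iX' eX eX'.
pose k := colin_comp (lunit Y)
  (colin_comp (tens_mor mX' (colin_id Y)) (unassoc X' Y' Y)).
exists (colin_comp mX (colin_comp (tens_mor (colin_id X) k)
  (assoc X X' (Y' \oxc Y)))); split.
  apply: iso_ccomp iX _; apply: iso_ccomp (iso_assoc _ _ _).
  apply: iso_tens (iso_cid _) _; apply: iso_ccomp (iso_lunit _) _.
  by apply: iso_ccomp (iso_unassoc _ _ _); apply: iso_tens iX' (iso_cid _).
apply: colinearP; elim/tens3_ind => [x x' w|w w' Iw Iw']; last first.
  by rewrite !colinD Iw Iw'.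
elim/tens_ind: w => [y' y|w w' Iw Iw']; last first.
  by rewrite !tpureDr !colinD Iw Iw'.
rewrite !sub_prodE !colin_compE assocE tens_morE !colin_compE unassocE tens_morE.
rewrite lunitE -[u (mX _)]/(colin_comp u mX _) eX sub_prodE colinZ -alg_mul1l.
rewrite -[u (mX' _)]/(colin_comp u mX' _) eX' sub_prodE /=.
by rewrite !alg_mulA.
Qed.

Lemma sub_inverse_prod (X Y X' Y' : comodule H) (i : colinear X A)
    (j : colinear Y A) (i' : colinear X' A) (j' : colinear Y' A) :
    sub_inverse i j -> sub_inverse i' j' ->
  sub_inverse (sub_prod i i') (sub_prod j' j).
Proof.
move=> [mX [mY [iX iY eX eY]]] [mX' [mY' [iX' iY' eX' eY']]].
have [n [ni ne]] := sub_contract iX iX' eX eX'.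
have [n' [n'i n'e]] := sub_contract iY' iY eY' eY.
by exists n, n'.
Qed.

(* Monomorphisms i_X : X -> A admitting an inverse i_Y : Y -> A. *)
Record inv_mono := InvMono {
  inv_car : comodule H;
  inv_inc : colinear inv_car A;
  inv_incP : mono inv_inc;
  inv_ex : exists (Y : comodule H) (j : colinear Y A),
    mono j /\ sub_inverse inv_inc j }.

(* Two monomorphisms define the same subobject of A. *)
Definition same_sub (X X' : inv_mono) : Prop :=
  exists f : colinear (inv_car X) (inv_car X'),
    iso f /\ colin_comp (inv_inc X') f = inv_inc X.

Lemma same_sub_refl X : same_sub X X.
Proof.
by exists (colin_id _); split; [exact: iso_cid | exact: colinearP].
Qed.

Lemma same_sub_sym X X' : same_sub X X' -> same_sub X' X.
Proof.
move=> [f [[f' [f'f ff']] e]]; exists f'; split; first by exists f.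
rewrite -e; apply: colinearP => x; rewrite !colin_compE.
by congr (inv_inc _ _); exact: (colin_eq ff' x).
Qed.

Lemma same_sub_trans Y X Z : same_sub X Y -> same_sub Y Z -> same_sub X Z.
Proof.
move=> [f [fi fe]] [g [gi ge]]; exists (colin_comp g f).
split; first exact: iso_ccomp.
by rewrite -fe -ge; apply: colinearP.
Qed.

(* Inv_R^H(A), the set of classes of same_sub. *)
Definition inv_sub : Type :=
  {C : inv_mono -> Prop | exists X, C = same_sub X}.

Definition inv_class (X : inv_mono) : inv_sub :=
  exist _ (same_sub X) (ex_intro _ X erefl).

Definition inv_repr (C : inv_sub) : inv_mono := projT1 (cid (proj2_sig C)).

Lemma inv_classP X X' : same_sub X X' <-> inv_class X = inv_class X'.
Proof.
split=> [XX'|[->]]; last exact: same_sub_refl.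
apply: eq_exist => /=; apply/funext => Y; apply/propext.
by split; apply: same_sub_trans => //; exact: same_sub_sym.
Qed.

Lemma inv_classK (C : inv_sub) : inv_class (inv_repr C) = C.
Proof.
rewrite /inv_class /inv_repr; case: C => C CP /=.
by apply: eq_exist; case: cid => X /= ->.
Qed.

Lemma inv_mono_mul_mono (X X' : inv_mono) :
  mono (sub_prod (inv_inc X) (inv_inc X')).
Proof.
have [Y [j [_ Yj]]] := inv_ex X.
exact: sub_prod_mono Yj (@inv_incP X) (@inv_incP X').
Qed.

Lemma inv_mono_mul_ex (X X' : inv_mono) :
  exists (Y : comodule H) (j : colinear Y A),
    mono j /\ sub_inverse (sub_prod (inv_inc X) (inv_inc X')) j.
Proof.
have [Y [j [jM jP]]] := inv_ex X; have [Y' [j' [j'M j'P]]] := inv_ex X'.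
exists (Y' \oxc Y), (sub_prod j' j); split; last exact: sub_inverse_prod.
exact: sub_prod_mono (sub_inverse_sym j'P) j'M jM.
Qed.

Definition inv_mono_mul (X X' : inv_mono) : inv_mono :=
  InvMono (@inv_mono_mul_mono X X') (inv_mono_mul_ex X X').

Lemma inv_mono_sym_subproof (X : inv_mono) :
  {Yj : {Y : comodule H & colinear Y A}
      | mono (projT2 Yj) /\ sub_inverse (inv_inc X) (projT2 Yj)}.
Proof.
by apply: cid; have [Y [j jP]] := inv_ex X; exists (existT _ Y j).
Qed.

Definition inv_mono_sym (X : inv_mono) : inv_mono :=
  let: exist (existT Y j) jP := inv_mono_sym_subproof X in
  @InvMono Y j jP.1
    (ex_intro _ (inv_car X) (ex_intro _ (inv_inc X)
      (conj (@inv_incP X) (sub_inverse_sym jP.2)))).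

Lemma inv_mono_symP (X : inv_mono) :
  sub_inverse (inv_inc X) (inv_inc (inv_mono_sym X)).
Proof. by rewrite /inv_mono_sym; case: inv_mono_sym_subproof => -[Y j] []. Qed.

Definition inv_mul (X X' : inv_sub) : inv_sub :=
  inv_class (inv_mono_mul (inv_repr X) (inv_repr X')).
Definition inv_inv (X : inv_sub) : inv_sub := inv_class (inv_mono_sym (inv_repr X)).

Lemma inv_mulE X X' :
  inv_mul (inv_class X) (inv_class X') = inv_class (inv_mono_mul X X').
Proof.
have rP Z : same_sub (inv_repr (inv_class Z)) Z by apply/inv_classP/inv_classK.
apply/inv_classP; have [f [fi fe]] := rP X; have [g [gi ge]] := rP X'.
exists (tens_mor f g); split; first exact: iso_tens.
apply: colinearP; elim/tens_ind => [x x'|z z' Iz Iz']; last first.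
  by rewrite !colinD Iz Iz'.
by rewrite colin_compE tens_morE [LHS]sub_prodE [RHS]sub_prodE -fe -ge.
Qed.

Lemma inv_mulA : associative inv_mul.
Proof.
move=> X Y Z; rewrite -(inv_classK X) -(inv_classK Y) -(inv_classK Z).
rewrite !inv_mulE; apply/inv_classP; exists (unassoc _ _ _).
split; first exact: iso_unassoc.
apply: colinearP; elim/tens3r_ind => [x y z|w w' Iw Iw']; last first.
  by rewrite !colinD Iw Iw'.
by rewrite colin_compE unassocE !sub_prodE alg_mulA.
Qed.

End Subcomodules.

(* The unit of an Azumaya algebra is a monomorphism; this is what makes
   (R[1], u) a subobject of A, hence the neutral element of Inv_R^H(A). *)
Lemma equivalence_faithful (C D : category) (F : functor C D) :
  is_equivalence F ->
  forall (X Y : C) (f g : hom X Y), fmap F f = fmap F g -> f = g.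
Proof.
move=> [G [[eta [eta_iso etaN]] _]] X Y f g efg.
have [e [ee ee']] := eta_iso X.
have /= ef := etaN _ _ f; have /= eg := etaN _ _ g.
have : compm f (eta X) = compm g (eta X) by rewrite -ef -eg efg.
by move=> /(congr1 (fun h => compm h e)); rewrite -!compmA ee' !compm1.
Qed.

Lemma azumaya_unit_mono (A : comod_alg H) : azumaya A -> mono (alg_one A).
Proof.
move=> [Aeq _] T f g efg; apply: (equivalence_faithful Aeq).
apply: bimod_homP; elim/tens_ind => [a x|z z' Iz Iz']; last first.
  by rewrite !colinD Iz Iz'.
apply: etrans (ind_homE f a x) (etrans _ (esym (ind_homE g a x))).
have rE (h : colinear T 1c) :
    a \ox h x = alg_mul A (a \ox alg_one A (h x)) \ox (1 : unit_mod R).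
  rewrite alg_mul1r tpureZl -tpureZr; congr (_ \ox _); exact/esym/mulr1.
rewrite !rE; congr (alg_mul A (_ \ox _) \ox _).
exact: (colin_eq efg x).
Qed.

Section InvGroup.
Variable A : comod_alg H.
Hypothesis Az : azumaya A.
Local Notation u := (alg_one A).

Lemma inv_unit_ex : exists (Y : comodule H) (j : colinear Y A),
  mono j /\ sub_inverse u j.
Proof.
exists 1c, u; split; first exact: azumaya_unit_mono Az.
have e : colin_comp u (lunit 1c) = sub_prod u u.
  apply: colinearP; elim/tens_ind => [r x|z z' Iz Iz']; last first.
    by rewrite !colinD Iz Iz'.
  by rewrite sub_prodE colin_compE lunitE colinZ -alg_mul1l.
by exists (lunit 1c), (lunit 1c); split=> //; apply: iso_lunit.
Qed.

Definition inv_unit : inv_mono A :=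
  InvMono (azumaya_unit_mono Az) inv_unit_ex.

Definition inv_one : inv_sub A := inv_class inv_unit.

Lemma inv_mul1 : left_id inv_one (@inv_mul A).
Proof.
move=> X; rewrite -(inv_classK X) inv_mulE; apply/inv_classP.
exists (lunit _); split; first exact: iso_lunit.
apply: colinearP; elim/tens_ind => [r x|z z' Iz Iz']; last first.
  by rewrite !colinD Iz Iz'.
by rewrite sub_prodE colin_compE lunitE colinZ -alg_mul1l.
Qed.

Lemma inv_mulr1 : right_id inv_one (@inv_mul A).
Proof.
move=> X; rewrite -(inv_classK X) inv_mulE; apply/inv_classP.
exists (colin_comp (lunit _) (flip _ 1c)); split.
  exact: iso_ccomp (iso_lunit _) (iso_flip _ _).
apply: colinearP; elim/tens_ind => [x r|z z' Iz Iz']; last first.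
  by rewrite !colinD Iz Iz'.
by rewrite sub_prodE !colin_compE flipE lunitE colinZ -alg_mul1r.
Qed.

Lemma inv_mulV : left_inverse inv_one (@inv_inv A) (@inv_mul A).
Proof.
move=> X; rewrite -{2}(inv_classK X) inv_mulE; apply/inv_classP.
by have [mX [mY [iX iY eX eY]]] := inv_mono_symP (inv_repr X); exists mY.
Qed.

Lemma inv_mulrV : right_inverse inv_one (@inv_inv A) (@inv_mul A).
Proof.
move=> X; rewrite -{1}(inv_classK X) inv_mulE; apply/inv_classP.
by have [mX [mY [iX iY eX eY]]] := inv_mono_symP (inv_repr X); exists mX.
Qed.

Definition inv_group : group := Group
  (@inv_mulA A) inv_mul1 inv_mulr1 inv_mulV inv_mulrV.
End InvGroup.
End InvertibleSubcomodules.

(* Main.v *)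
(* A colinear automorphism theta and an invertible subobject i : X -> A
   correspond to each other when i(x) a = theta(a) i(x).  If X has inverse
   j : Y -> A and 1 = \sum i(x_k) j(y_k), then theta(a) = \sum i(x_k) a j(y_k).
   Conversely, the equivalence A \ox - produces X from the bimodule A whose left
   action is twisted by theta: the isomorphism A \ox X -> A has the form
   a \ox x |-> i(x) a.  The products i(x) j(y) and j(y) i(x), where j belongs to
   the inverse of theta, are central, and full faithfulness of A \ox - makes
   every central morphism N -> A factor through the unit. *)
Require Import Defs.
From mathcomp Require Import all_boot all_algebra.
From mathcomp Require Import boolp.

Set Implicit Arguments.
Unset Strict Implicit.
Unset Printing Implicit Defensive.

Import GRing.Theory.
Local Open Scope ring_scope.

Local Notation hom := Defs.hom.

(** * Fullness, reflection of isomorphisms and essential surjectivity *)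

Section Equivalences.
Variables (C D : category) (F : functor C D).

(** The quasi-inverse [G] is itself an equivalence, hence faithful, so the preimage only has to be
    checked after applying [G], where naturality of [eta] settles it. *)
Lemma equivalence_full : is_equivalence F ->
  forall (X Y : C) (h : hom (F X) (F Y)), exists f : hom X Y, fmap F f = h.
Proof.
move=> [G [GF FG]] X Y h.
have G_faithful := equivalence_faithful (ex_intro _ F (conj FG GF)).
have [eta [eta_iso etaN]] := GF.
have [eX [eXl eXr]] := eta_iso X; have [eY [eYl eYr]] := eta_iso Y.
exists (compm (eta Y) (compm (fmap G h) eX)); apply: G_faithful.
have /= := etaN _ _ (compm (eta Y) (compm (fmap G h) eX)).
rewrite -!compmA eXl compm1 => /(congr1 (compm eY)).
by rewrite !compmA eYl !comp1m.
Qed.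

Lemma equivalence_reflects_iso : is_equivalence F ->
  forall (X Y : C) (f : hom X Y), is_iso (fmap F f) -> is_iso f.
Proof.
move=> Feq X Y f [h [hf fh]].
have [g gE] := equivalence_full Feq h; exists g.
by split; apply: (equivalence_faithful Feq); rewrite fmapM fmap1 gE.
Qed.

Lemma equivalence_ess_surj : is_equivalence F ->
  forall M : D, exists (X : C) (e : hom (F X) M), is_iso e.
Proof.
by move=> [G [_ [eps [eps_iso _]]]] M; exists (G M), (eps M); exact: eps_iso.
Qed.
End Equivalences.

(** * Twisted commutation and central morphisms *)

Section Automorphisms.
Variables (R : comPzRingType) (H : hopf_algebroid R) (A : comod_alg H).
Local Notation "1c" := (unit_comod H).
Local Notation "M \oxc N" := (tens_comod M N) (at level 40, left associativity).
Local Notation mono i := (@is_mono (Comod H) _ _ i).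
Local Notation iso i := (@is_iso (Comod H) _ _ i).
Local Notation m := (alg_mul A).
Local Notation u := (alg_one A).

Lemma iso_can (M N : comodule H) (f : colinear M N) :
  iso f -> exists g : colinear N M, cancel f g /\ cancel g f.
Proof.
move=> [g [gf fg]]; exists g.
by split=> x; [exact: (colin_eq gf x) | exact: (colin_eq fg x)].
Qed.

Lemma iso_bimod (M N : bimod A) (f : bimod_hom M N) :
  iso (f : colinear M N) -> @is_iso (Bimods A) _ _ f.
Proof.
move=> /iso_can [g [gK fK]].
have gl a x : g (lact N (a \ox x)) = lact M (a \ox g x).
  by rewrite -{1}(fK x) -bimod_lact gK.
have gr x a : g (ract N (x \ox a)) = ract M (g x \ox a).
  by rewrite -{1}(fK x) -bimod_ract gK.
by exists (BimodHom gl gr); split; apply: bimod_homP.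
Qed.

Lemma bimod_iso_comod (M N : bimod A) (f : bimod_hom M N) :
  @is_iso (Bimods A) _ _ f -> iso (f : colinear M N).
Proof.
move=> [g [gf fg]]; apply: (@iso_cancel _ _ _ _ f g) => x.
  exact: (congr1 (fun k : bimod_hom M M => k x) gf).
exact: (congr1 (fun k : bimod_hom N N => k x) fg).
Qed.

(** A bare function [th] allows [id] and composites, and keeps the relation apart from the proof
    that [th] is an automorphism. *)
Definition implements (X : comodule H) (i : colinear X A) (th : A -> A) : Prop :=
  forall x a, m (i x \ox a) = m (th a \ox i x).

Lemma implements_prod (X X' : comodule H) (i : colinear X A)
    (i' : colinear X' A) (th th' : A -> A) :
  implements i th -> implements i' th' ->
  implements (sub_prod i i') (fun a => th (th' a)).
Proof.
move=> iE i'E z a; elim/tens_ind: z => [x x'|z z' Iz Iz'].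
  by rewrite sub_prodE alg_mulA i'E -alg_mulA iE alg_mulA.
by rewrite !(tpureDl, tpureDr, colinD) Iz Iz'.
Qed.

(* implements n id says that the image of n is central. *)
Lemma central_factor (N : comodule H) (n : colinear N A) :
    azumaya A -> implements n id ->
  exists f : colinear N 1c, colin_comp u f = n /\
    (iso (sub_prod (colin_id A) n) -> iso f).
Proof.
move=> [Aeq _] nC.
pose s := sub_prod (colin_id A) n.
have sE a z : s (a \ox z) = m (a \ox n z) by rewrite sub_prodE.
pose run : colinear A (A \oxc 1c) :=
  colin_comp (flip 1c A) (unlunit A).
have runE' a : run a = a \ox (1 : unit_mod R) by rewrite colin_compE flipE.
pose h := colin_comp run s.
have hE a z : h (a \ox z) = m (a \ox n z) \ox (1 : unit_mod R).
  by rewrite colin_compE runE' sE.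
have hl a z : h (ind_lact A N (a \ox z)) = ind_lact A 1c (a \ox h z).
  elim/tens_ind: z => [c z|z z' Iz Iz']; last first.
    by rewrite !(tpureDr, colinD) Iz Iz'.
  by rewrite ind_lactE !hE ind_lactE alg_mulA.
(* Right linearity is where centrality enters: it compares [c a n(z)] with [c n(z) a]. *)
have hr z a : h (ind_ract A N (z \ox a)) = ind_ract A 1c (h z \ox a).
  elim/tens_ind: z => [c z|z z' Iz Iz']; last first.
    by rewrite !(tpureDl, colinD) Iz Iz'.
  by rewrite ind_ractE !hE ind_ractE !alg_mulA nC.
pose hb : bimod_hom (ind_bimod A N) (ind_bimod A 1c) :=
    @BimodHom R H A (ind_bimod A N) (ind_bimod A 1c) h hl hr.
have [f fE] := equivalence_full Aeq (hb : @hom (Bimods A) _ _).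
exists f; split.
  apply: colinearP => z; rewrite colin_compE.
  pose q : colinear (A \oxc 1c) A := sub_prod (colin_id A) u.
  (* Evaluating at [1 \ox z] and multiplying out recovers [u (f z) = n z]. *)
  have : q (ind_hom A f (u (1 : R) \ox z)) = q (hb (u (1 : R) \ox z)).
    by rewrite -fE.
  rewrite ind_homE hE !sub_prodE /= alg_mul1l1.
  by rewrite alg_mul1r1 alg_mul1l1.
(* The image of [f] under the equivalence is [s] followed by the isomorphism [run]. *)
move=> s_iso; apply: (equivalence_reflects_iso Aeq (f := f : @hom (Comod H) _ _)).
rewrite fE; apply: iso_bimod.
apply: (@iso_ccomp _ _ _ _ _ run s _ s_iso).
exact: iso_ccomp (iso_flip _ _) (iso_cancel (@unlunitK _ _ A) (@lunitK _ _ A)).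
Qed.

(** * From an automorphism to an invertible subobject *)

Section Twist.
Variable th : alg_aut A.

Definition twist_lact : colinear (A \oxc A) A := sub_prod th (colin_id A).

Lemma twist_lactE a x : twist_lact (a \ox x) = m (th a \ox x).
Proof. exact: sub_prodE. Qed.

Lemma twist_lact1 x : twist_lact (u (1 : R) \ox x) = x.
Proof. by rewrite twist_lactE aut1 alg_mul1l1. Qed.

Lemma twist_lactA a b x :
  twist_lact (m (a \ox b) \ox x) = twist_lact (a \ox twist_lact (b \ox x)).
Proof. by rewrite !twist_lactE autM alg_mulA. Qed.

Lemma twist_lractA a x b :
  m (twist_lact (a \ox x) \ox b) = twist_lact (a \ox m (x \ox b)).
Proof. by rewrite !twist_lactE alg_mulA. Qed.

Definition twist_bimod : bimod A :=
  @Bimod R H A A twist_lact m twist_lact1 twist_lactA (@alg_mul1r1 _ _ A)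
    (fun x a b => esym (@alg_mulA _ _ A x a b)) twist_lractA.

(** In [A \ox X] the element [a \ox x] is both [a (1 \ox x)] and [(1 \ox x) a]. A bimodule
    isomorphism [e] onto the twisted [A], with [i(x) = e(1 \ox x)], therefore sends it to
    [th(a) i(x)] and to [i(x) a]. *)
Lemma implementer_ex : azumaya A ->
  exists (X : comodule H) (i : colinear X A),
    [/\ implements i th, mono i
      & iso (colin_comp (sub_prod i (colin_id A)) (flip A X))].
Proof.
move=> [Aeq _].
have [X [e e_iso]] := equivalence_ess_surj Aeq twist_bimod.
move: X e e_iso => /= X e /bimod_iso_comod e_iso.
pose i : colinear X A := colin_comp (e : colinear (A \oxc X) A)
  (colin_comp (tens_mor u (colin_id X)) (unlunit X)).
have iE x : i x = e (u (1 : R) \ox x) by rewrite !colin_compE tens_morE.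
have er a x : e (a \ox x) = m (i x \ox a).
  rewrite iE; apply: esym; apply: etrans (esym (bimod_ract e _ a)) _.
  by congr (e _); apply: etrans (ind_ractE _ _ _) _; rewrite alg_mul1l1.
have el a x : e (a \ox x) = m (th a \ox i x).
  rewrite iE -twist_lactE; apply: esym; apply: etrans (esym (bimod_lact e a _)) _.
  by congr (e _); apply: etrans (ind_lactE _ _ _) _; rewrite alg_mul1r1.
have eE : colin_comp (sub_prod i (colin_id A)) (flip A X) = e.
  apply: colinearP; elim/tens_ind => [a x|z z' Iz Iz']; last first.
    by rewrite !colinD Iz Iz'.
  by rewrite colin_compE flipE sub_prodE er.
exists X, i; split; first by move=> x a; rewrite -er el.
  (* If [i] equalizes [f] and [g], then so does [e] after tensoring them with [A]; injectivity of
     [e] and faithfulness of the equivalence give [f = g]. *)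
  move=> T f g fg; apply: (equivalence_faithful Aeq).
  apply: bimod_homP; elim/tens_ind => [a t|z z' Iz Iz']; last first.
    by rewrite !colinD Iz Iz'.
  have [e' [eK _]] := iso_can e_iso; apply: (can_inj eK).
  rewrite !ind_homE !er; congr (m (_ \ox _)); exact: (colin_eq fg t).
by rewrite eE.
Qed.
End Twist.

Lemma implementer_invertible (th : alg_aut A) : azumaya A ->
  exists X : inv_mono A, implements (inv_inc X) th.
Proof.
move=> Az.
(* One half of [sub_inverse]; it is applied to [th] and its inverse in both orders. *)
have half (X Y : comodule H) (i : colinear X A) (j : colinear Y A)
    (t t' : alg_aut A) : implements i t -> implements j t' -> cancel t' t ->
    iso (colin_comp (sub_prod i (colin_id A)) (flip A X)) ->
    iso (colin_comp (sub_prod j (colin_id A)) (flip A Y)) ->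
  exists mX : colinear (X \oxc Y) 1c, iso mX /\ colin_comp u mX = sub_prod i j.
  move=> iE jE tK i_iso j_iso.
  have cE : implements (sub_prod i j) id.
    by move=> z a; rewrite (implements_prod iE jE) tK.
  have [f [fE f_iso]] := central_factor Az cE; exists f; split=> //; apply: f_iso.
  (* By centrality [a i(x) j(y) = i(x) (j(y) a)], so the map splits into the two given isomorphisms,
     up to reordering the factors. *)
  pose p := colin_comp (colin_comp (sub_prod i (colin_id A)) (flip A X))
    (colin_comp
      (tens_mor (colin_comp (sub_prod j (colin_id A)) (flip A Y)) (colin_id X))
      (colin_comp (unassoc A Y X) (tens_mor (colin_id A) (flip X Y)))).
  have -> : sub_prod (colin_id A) (sub_prod i j) = p.
    apply: colinearP; elim/tens3r_ind => [a x y|z z' Iz Iz']; last first.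
      by rewrite !colinD Iz Iz'.
    have flE (Z : comodule H) (k : colinear Z A) b z :
        colin_comp (sub_prod k (colin_id A)) (flip A Z) (b \ox z) = m (k z \ox b).
      by rewrite colin_compE flipE sub_prodE.
    rewrite sub_prodE -cE sub_prodE alg_mulA -!flE.
    rewrite [RHS]colin_compE; congr (colin_comp _ _ _).
    rewrite colin_compE [X in _ = tens_mor _ _ X]colin_compE tens_morE !flipE.
    by rewrite unassocE tens_morE colin_compE !flipE.
  apply: iso_ccomp => //; apply: iso_ccomp.
    exact: iso_tens j_iso (iso_cid _).
  exact: iso_ccomp (iso_unassoc _ _ _) (iso_tens (iso_cid _) (iso_flip _ _)).
have [X [i [iE iM i_iso]]] := implementer_ex th Az.
have [Y [j [jE jM j_iso]]] := implementer_ex (aut_sym th) Az.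
have [mX [mX_iso mXE]] := half _ _ _ _ _ _ iE jE (@aut_invK _ _ _ th) i_iso j_iso.
have [mY [mY_iso mYE]] := half _ _ _ _ _ _ jE iE (@aut_funK _ _ _ th) j_iso i_iso.
have iV : exists (Y : comodule H) (j : colinear Y A), mono j /\ sub_inverse i j.
  by exists Y, j; split=> //; exists mX, mY.
by exists (InvMono iM iV).
Qed.

(** * From an invertible subobject to an automorphism *)

Section InverseSubobjects.
Variables (X Y : comodule H) (i : colinear X A) (j : colinear Y A).

(** This is the decomposition [1 = \sum i(x_k) j(y_k)]. It is kept as a morphism [w], not just an
    element, so that maps built from it stay colinear. *)
Lemma sub_inverse_unit : sub_inverse i j -> exists w : colinear 1c (X \oxc Y),
  sub_prod i j (w (1 : R)) = u (1 : R).
Proof.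
move=> [mX [_ [/iso_can[w [_ wK]] _ eX _]]]; exists w.
by rewrite -eX colin_compE wK.
Qed.

(** Since [a = \sum a i(x_k) j(y_k)], the products [a i(x)] determine [a]. *)
Lemma sub_inverse_cancel a b : sub_inverse i j ->
  (forall x, m (a \ox i x) = m (b \ox i x)) -> a = b.
Proof.
move=> /sub_inverse_unit[w w1] ab.
rewrite -[a]alg_mul1r1 -[b]alg_mul1r1 -w1.
elim/tens_ind: (w _) => [x y|z z' Iz Iz'].
  by rewrite sub_prodE -!alg_mulA ab.
by rewrite colinD !tpureDr !colinD Iz Iz'.
Qed.

Lemma sub_inverse_conj : sub_inverse i j ->
  exists th : colinear A A, implements i th.
Proof.
move=> ij; have [w w1] := sub_inverse_unit ij.
have [q qE] : exists q : Y -> X -> R, forall y x, m (j y \ox i x) = u (q y x).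
  by case: ij => [_ [mY [_ _ _ eY]]]; exists (fun y x => mY (y \ox x)) => y x;
    rewrite -sub_prodE -eY.
pose c : colinear ((X \oxc Y) \oxc A) A := colin_comp
  (sub_prod i (colin_comp (sub_prod (colin_id A) j) (flip Y A))) (assoc X Y A).
have cE x y a : c ((x \ox y) \ox a) = m (i x \ox m (a \ox j y)).
  by rewrite colin_compE assocE sub_prodE colin_compE flipE sub_prodE.
pose th : colinear A A :=
  colin_comp c (colin_comp (tens_mor w (colin_id A)) (unlunit A)).
have thE a : th a = c (w (1 : R) \ox a) by rewrite !colin_compE tens_morE.
(* The product [j(y) i(x)] is a scalar, so it moves past [a]; at [z = w 1] this becomes
   [th(a) i(x) = i(x) a]. *)
have cx z x a : m (c (z \ox a) \ox i x) = m (sub_prod i j z \ox m (i x \ox a)).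
  elim/tens_ind: z => [x1 y|z z' Iz Iz']; last first.
    by rewrite !(colinD, tpureDl) Iz Iz'.
  rewrite cE sub_prodE !alg_mulA qE -[m (j y \ox _)]alg_mulA qE.
  by rewrite alg_mul1r alg_mul1l.
by exists th => x a; rewrite thE cx w1 alg_mul1l1.
Qed.
End InverseSubobjects.

Lemma implements_unique (X Y : comodule H) (i : colinear X A)
    (j : colinear Y A) (t t' : A -> A) : sub_inverse i j ->
  implements i t -> implements i t' -> t =1 t'.
Proof.
by move=> ij iE iE' a; apply: (sub_inverse_cancel ij) => x; rewrite -iE -iE'.
Qed.

Lemma implemented_aut (X : inv_mono A) :
  exists th : alg_aut A, implements (inv_inc X) th.
Proof.
have [Y [j [_ ij]]] := inv_ex X; have ji := sub_inverse_sym ij.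
have [t tE] := sub_inverse_conj ij; have [t' t'E] := sub_inverse_conj ji.
(* After multiplication by [i(x)], both sides equal [i(x) a b]. *)
have tM a b : t (m (a \ox b)) = m (t a \ox t b).
  apply: (sub_inverse_cancel ij) => x.
  by rewrite -tE alg_mulA -tE -!alg_mulA tE.
have t1 (r : R) : t (u r) = u r.
  by apply: (sub_inverse_cancel ij) => x; rewrite -tE alg_mul1r alg_mul1l.
(* Here [f(g(a)) v(x) w(y) = v(x) w(y) a], and [v(x) w(y)] is a scalar. *)
have inverse (V W : comodule H) (v : colinear V A) (w : colinear W A)
    (f g : A -> A) : sub_inverse v w -> implements v f -> implements w g ->
  cancel g f.
  move=> vw vE wE a; apply: (sub_inverse_cancel vw) => x.
  apply: (sub_inverse_cancel (sub_inverse_sym vw)) => y.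
  rewrite -vE !alg_mulA -wE.
  case: vw => [mV [_ [_ _ eV _]]].
  have vwE : m (v x \ox w y) = u (mV (x \ox y)) by rewrite -sub_prodE -eV.
  by rewrite -alg_mulA vwE alg_mul1l alg_mul1r.
exists (AlgAut tM t1 (inverse _ _ _ _ _ _ ji t'E tE)
  (inverse _ _ _ _ _ _ ij tE t'E)).
exact: tE.
Qed.

(** * Uniqueness of the implementing subobject *)

Lemma same_sub_implements (X X' : inv_mono A) (th : A -> A) :
  same_sub X X' -> implements (inv_inc X') th -> implements (inv_inc X) th.
Proof. by move=> [f [_ fE]] X'E x a; rewrite -fE colin_compE. Qed.

Lemma implements_factor (X X' : inv_mono A) (th : alg_aut A) : azumaya A ->
    implements (inv_inc X) th -> implements (inv_inc X') th ->
  exists f : colinear (inv_car X) (inv_car X'),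
    colin_comp (inv_inc X') f = inv_inc X.
Proof.
move=> Az XE X'E; have [Y [j [_ ij]]] := inv_ex X'.
have [w w1] := sub_inverse_unit ij.
(* The inverse [j] implements the inverse twist, so [j(y) i_X(x)] is central. *)
have jE b y : m (j y \ox th b) = m (b \ox j y).
  apply: (sub_inverse_cancel ij) => x.
  case: ij => [_ [mY [_ _ _ eY]]].
  have jiE : m (j y \ox inv_inc X' x) = u (mY (y \ox x)).
    by rewrite -sub_prodE -eY.
  rewrite alg_mulA -X'E -alg_mulA jiE alg_mul1l.
  by rewrite alg_mulA jiE alg_mul1r.
have cE : implements (sub_prod j (inv_inc X)) id.
  move=> z a; elim/tens_ind: z => [y x|z z' Iz Iz']; last first.
    by rewrite !(tpureDl, tpureDr, colinD) Iz Iz'.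
  by rewrite sub_prodE alg_mulA XE -alg_mulA jE alg_mulA.
have [f [fE _]] := central_factor Az cE.
(* The factorization comes from [i_X(x) = \sum i_X'(x'_k) (j(y_k) i_X(x))], whose bracket is the
   scalar [f(y_k \ox x)]. *)
pose k : colinear ((inv_car X' \oxc Y) \oxc inv_car X) (inv_car X') :=
  colin_comp (lunit _) (colin_comp (flip _ 1c)
    (colin_comp (tens_mor (colin_id _) f) (assoc _ _ _))).
have kE x z : inv_inc X' (k (z \ox x)) =
    m (sub_prod (inv_inc X') j z \ox inv_inc X x).
  elim/tens_ind: z => [x' y|z z' Iz Iz']; last first.
    by rewrite !(tpureDl, colinD) Iz Iz'.
  rewrite sub_prodE alg_mulA !colin_compE assocE tens_morE flipE lunitE colinZ.
  by rewrite -[m (j y \ox _)]sub_prodE -fE colin_compE alg_mul1r.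
exists (colin_comp k (colin_comp (tens_mor w (colin_id _)) (unlunit _))).
apply: colinearP => x.
by rewrite !colin_compE tens_morE kE w1 alg_mul1l1.
Qed.

(** The factorizations in both directions are mutually inverse because the inclusions are
    monomorphisms. *)
Lemma implements_same_sub (X X' : inv_mono A) (th : alg_aut A) : azumaya A ->
    implements (inv_inc X) th -> implements (inv_inc X') th ->
  same_sub X X'.
Proof.
move=> Az XE X'E.
have [f fE] := implements_factor Az XE X'E.
have [g gE] := implements_factor Az X'E XE.
exists f; split=> //; exists g; split.
  by apply: (@inv_incP _ _ _ X); apply: colinearP => x; rewrite -{2}fE -gE.
by apply: (@inv_incP _ _ _ X'); apply: colinearP => x; rewrite -{2}gE -fE.
Qed.
End Automorphisms.

(** * The isomorphism of groups *)

Theorem corollary5p5 (R : comPzRingType) (H : hopf_algebroid R)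
    (Hflat : flat H) (A : comod_alg H) (Az : azumaya A)
    (AA_divides_A : bimod_divides (outer_bimod A) (reg_bimod A))
    (R1_generator : is_generator (unit_comod H : Comod H)) :
  group_isomorphic (inv_group Az) (aut_group A).
Proof.
pose phi (C : inv_sub A) : alg_aut A := projT1 (cid (implemented_aut (inv_repr C))).
pose psi (th : alg_aut A) : inv_sub A :=
  inv_class (projT1 (cid (implementer_invertible th Az))).
(* By uniqueness of the implemented map, [phi] can be computed from any representative and any
   automorphism it implements. *)
have phiE X (th : alg_aut A) : implements (inv_inc X) th -> phi (inv_class X) = th.
  move=> XE; rewrite /phi; case: cid => t /= tE; apply: alg_autP.
  have [Y [j [_ ij]]] := inv_ex (inv_repr (inv_class X)).
  apply: (implements_unique ij tE); apply: same_sub_implements XE.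
  exact/inv_classP/inv_classK.
exists phi; split.
  exists psi => [C|th]; rewrite /psi; case: cid => X /= XE; last exact: phiE.
  (* The chosen subobject and the representative of [C] implement the same automorphism. *)
  rewrite -(inv_classK C); apply/inv_classP; apply: (implements_same_sub Az XE).
  by rewrite /phi; case: cid.
move=> C C'; rewrite /= -(inv_classK C) -(inv_classK C') inv_mulE.
set X := inv_repr C; set X' := inv_repr C'.
have [t tE] := implemented_aut X; have [t' t'E] := implemented_aut X'.
rewrite (phiE _ _ tE) (phiE _ _ t'E); apply: phiE.
exact: implements_prod tE t'E.
Qed.
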